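(* There exist universal constants $C_1,C_2>0$ such that the following holds. Let $f_1,\dots,f_n:\mathbb{R}^d\to\mathbb{R}$ and $f=\frac1n\sum_{i=1}^n f_i$. Assume that (1) each $f_i$ is differentiable and $L_i$-smooth, and let $L_{\max}=\max_{i\in[n]}L_i$; (2) each $f_i$ is convex, and $f$ attains its minimum at a (not necessarily unique) point $x_*$; (3) the stochastic gradients $\nabla f_i(x;\xi_i)$, $\xi_i\sim\mathcal{D}_i$, are unbiased and $\sigma^2$-variance-bounded, with $\sigma^2\ge 0$; (4) (strong interpolation) for all $i\in[n]$, a point is a minimizer of $f$ if and only if it is a minimizer of $f_i$; (5) (local Polyak-Łojasiewicz condition) there is $\mu>0$ with $\|\nabla f_i(x)\|^2\ge 2\mu(f_i(x)-f_i^* )$ for all $x\in\mathbb{R}^d$ and $i\in[n]$, where $f_i^*$ is the finite optimal value of $f_i$. Let $\varepsilon>0$, let $x^0\in\mathbb{R}^d$, $R=\|x^0-x_*\|$, and run Rennala SGD from $x^0$ with step size $\gamma=1/L_{\max}$ and parameter $S=\frac{4\sigma^2}{\mu L_{\max}\varepsilon}$. Then for every $k\ge C_1\frac{L_{\max}}{\mu}\max\{1,\log\frac{R^2}{\varepsilon}\}$, $$\mathbb{E}\left[\|x^{k+1}-x_*^{k+1}\|^2\right]\le\varepsilon,$$ where $x_*^{k+1}$ is the minimizer of $f$ closest to $x^{k+1}$. Moreover, under the fixed computation model with computation times $0<\tau_1\le\dots\le\tau_n$, the method finds such a point after at most $$C_2\min_{m\in[n]}\left[\left(\frac1m\sum_{i=1}^m\frac1{\tau_i}\right)^{-1}\left(\frac{L_{\max}}{\mu}+\frac{\sigma^2}{m\varepsilon\mu^2}\right)\right]\max\left\{1,\log\frac{R^2}{\varepsilon}\right\}$$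 seconds.
   Context: $[n]=\{1,\dots,n\}$; $\|\cdot\|$ is the Euclidean norm. A function $g$ is $L$-smooth if $\|\nabla g(x)-\nabla g(y)\|\le L\|x-y\|$ for all $x,y$. Unbiased, $\sigma^2$-variance-bounded: $\mathbb{E}_{\xi_i}[\nabla f_i(x;\xi_i)]=\nabla f_i(x)$ and $\mathbb{E}_{\xi_i}[\|\nabla f_i(x;\xi_i)-\nabla f_i(x)\|^2]\le\sigma^2$ for all $x\in\mathbb{R}^d$, $i\in[n]$. Distributed setting: $n$ workers operate in parallel and asynchronously; worker $i$ can compute stochastic gradients $\nabla f_i(x;\xi_i)$ at requested points. Every stochastic gradient uses a fresh independent sample, and computation times do not depend on the samples. Rennala SGD (inputs $x^0$, step size $\gamma$, parameter $S$): in each iteration $k=0,1,2,\dots$, all workers are asked to compute stochastic gradients at the same point $x^k$; whenever a worker finishes one, the result is collected and the worker is asked to compute another stochastic gradient at $x^k$. Let $B_i^k$ be the number of stochastic gradients $\nabla f_i(x^k;\xi_{ij}^k)$, $j=1,\dots,B_i^k$, collected so far from worker $i$ in iteration $k$ (initially $0$). Collection continues as long as $\sum_{i=1}^n B_i^k\le S$ and stops at the first moment when $\sum_{i=1}^n B_i^k>S$. Then $$x^{k+1}=x^k-\gamma\,\frac{1}{\sum_{i=1}^n B_i^k}\sum_{i=1}^n\sum_{j=1}^{B_i^k}\nabla f_i(x^k;\xi_{ij}^k),$$ all running computations are stopped (or their unfinished results are ignored in later iterations), and the next iteration starts. (This is the general scheme $x^{k+1}=x^k-\gamma\frac1n\sum_i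 w_i^k\sum_{j=1}^{B_i^k}\nabla f_i(x^k;\xi_{ij}^k)$ with weights $w_i^k=n/\sum_{i=1}^n B_i^k$.) Fixed computation model: worker $i$ requires at most $\tau_i$ seconds to compute one stochastic gradient. *)

(* Defs.v *)
From HB Require Import structures.
From mathcomp Require Import all_boot all_order all_algebra.
From mathcomp Require Import all_classical all_reals all_analysis.

Set Implicit Arguments.
Unset Strict Implicit.
Unset Printing Implicit Defensive.

Import Order.TTheory GRing.Theory Num.Theory.
Import numFieldNormedType.Exports.

Local Open Scope classical_set_scope.
Local Open Scope ring_scope.

Section Functions.
Context {R : realType} {d : nat}.
Implicit Types (f : 'rV[R]_d -> R) (x y p : 'rV[R]_d).

(* The library norm on matrices is the max norm; it induces the same topology,
   hence the same notion of differentiability. *)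
Definition enorm x : R := Num.sqrt (\sum_(l < d) x 0 l ^+ 2).

Definition grad f x : 'rV[R]_d := \row_(l < d) 'D_(delta_mx 0 l) f x.

Definition smooth (L : R) f : Prop :=
  forall x y, enorm (grad f x - grad f y) <= L * enorm (x - y).

Definition minimizer f x : Prop := forall y, f x <= f y.

(* [has_inf] says that the optimal value [inf (range f)] is finite. *)
Definition local_PL (mu : R) f : Prop :=
  has_inf (range f) /\
  forall x, 2 * mu * (f x - inf (range f)) <= enorm (grad f x) ^+ 2.

Definition closest_minimizer f x : 'rV[R]_d :=
  xget 0 [set p | minimizer f p /\
                  forall q, minimizer f q -> enorm (x - p) <= enorm (x - q)].

End Functions.

Definition average {R : realType} {d n : nat} (f : 'I_n -> 'rV[R]_d -> R)
    (x : 'rV[R]_d) : R :=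
  n%:R^-1 * \sum_(i < n) f i x.

Definition strong_interpolation {R : realType} {d n : nat}
    (f : 'I_n -> 'rV[R]_d -> R) : Prop :=
  forall i x, minimizer (average f) x <-> minimizer (f i) x.

Section Oracle.
Context {R : realType} {d : nat} {dX : measure_display} {X : measurableType dX}.
Implicit Types (D : probability X R) (g : 'rV[R]_d -> X -> 'rV[R]_d)
  (f : 'rV[R]_d -> R).

(* Joint measurability of (x, s) |-> g x s, needed for the expectations over
   the random iterates to make sense. Row vectors carry no sigma-algebra in the
   library, so R^d is read as d.-tuple R with its product Borel sigma-algebra. *)
Definition measurable_oracle g : Prop :=
  forall l : 'I_d,
    measurable_fun [set: d.-tuple R * X]
      (fun p => g (\row_(m < d) tnth p.1 m) p.2 0 l).

(* A finite value of the integral entails integrability. *)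
Definition unbiased D g f : Prop :=
  forall x (l : 'I_d), ('E_D[fun s => (g x s 0 l)%R] = (grad f x 0%R l)%:E)%E.

Definition variance_bounded (sigma2 : R) D g f : Prop :=
  forall x, ('E_D[fun s => (enorm (g x s - grad f x) ^+ 2)%R] <= sigma2%:E)%E.

End Oracle.

Section Samples.
Context {R : realType} {dO : measure_display} {Omega : measurableType dO}
  (P : probability Omega R).

Definition mutually_independent (I : choiceType) (dT : I -> measure_display)
    (T : forall e, measurableType (dT e)) (Y : forall e, Omega -> T e) : Prop :=
  forall (s : seq I) (A : forall e, set (T e)), uniq s ->
    (forall e, measurable (A e)) ->
    P (\bigcap_(e in [set` s]) (Y e @^-1` A e)) =
    (\prod_(e <- s) P (Y e @^-1` A e))%E.

(* [xi i k j] is the [j]-th sample (from 0) of worker [i] in iteration [k]. *)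
Definition fresh_samples (n : nat) (dX : 'I_n -> measure_display)
    (X : forall i, measurableType (dX i)) (D : forall i, probability (X i) R)
    (xi : forall i, nat -> nat -> {RV P >-> X i}) : Prop :=
  (forall i k j (A : set (X i)), measurable A ->
     distribution P (xi i k j) A = D i A) /\
  mutually_independent
    (fun (e : 'I_n * nat * nat) => xi e.1.1 e.1.2 e.2 : Omega -> X e.1.1).

End Samples.

(* One iteration, with time measured from its beginning. Times are extended
   reals: a worker may never finish. *)
Section Collection.
Context {R : realType} {n : nat}.
Implicit Types (r : 'I_n -> \bar R) (h c : 'I_n -> nat -> \bar R)
  (B : 'I_n -> nat).
Local Open Scope ereal_scope.

(* Completion time of the [j]-th gradient (from 0) of worker [i], which spends
   [h i l] seconds on its [l]-th gradient. The delay [r i] is the time for which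
   worker [i] is still busy with an unfinished computation of an earlier
   iteration, whose result is ignored; [r i = 0] if that computation has been
   stopped. *)
Definition finish_time r h (i : 'I_n) (j : nat) : \bar R :=
  r i + \sum_(l < j.+1) h i l.

(* First moment at which more than [S] gradients have been completed, where [c]
   gives the completion times; [+oo] if this never happens. *)
Definition stop_time (S : R) c : \bar R :=
  ereal_inf [set t | exists B, (S < (\sum_(i < n) B i)%:R)%R /\
                               forall i j, (j < B i)%N -> c i j <= t].

(* [B] are the numbers of gradients collected when the collection stops. If
   several gradients are completed exactly at the stopping moment, they may be
   collected all at once or one by one in any order, stopping as soon as more
   than [S] have been collected. *)
Definition collected (S : R) c B : Prop :=
  [/\ stop_time S c < +oo,
      (S < (\sum_(i < n) B i)%:R)%R,
      (forall i j, c i j < stop_time S c -> (j < B i)%N) &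
      (forall i j, (j < B i)%N -> c i j <= stop_time S c)].

End Collection.

Fixpoint rennala {R : realType} {d n : nat} {dX : 'I_n -> measure_display}
    {X : forall i, measurableType (dX i)} {Omega : Type}
    (g : forall i, 'rV[R]_d -> X i -> 'rV[R]_d) (gamma : R)
    (B : nat -> 'I_n -> nat) (xi : forall i, nat -> nat -> Omega -> X i)
    (x0 : 'rV[R]_d) (k : nat) (w : Omega) : 'rV[R]_d :=
  if k is k'.+1 then
    let x := rennala g gamma B xi x0 k' w in
    x - gamma *: ((\sum_(i < n) B k' i)%:R^-1 *:
                  \sum_(i < n) \sum_(j < B k' i) g i x (xi i k' j w))
  else x0.

(* A delay is the remaining part of a single gradient computation, so it obeys
   the same bound. *)
Definition fixed_computation_model {R : realType} {n : nat} (tau : 'I_n -> R)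
    (r : nat -> 'I_n -> \bar R) (h : nat -> 'I_n -> nat -> \bar R) : Prop :=
  (forall k i, (r k i <= (tau i)%:E)%E) /\
  (forall k i j, (h k i j <= (tau i)%:E)%E).

(* Main.v *)
Require Import Defs.
From HB Require Import structures.
From mathcomp Require Import all_boot all_order all_algebra.
From mathcomp Require Import all_classical all_reals all_analysis.
From mathcomp Require Import measurable_realfun ring lra.

(* One iteration moves [x] by a convex combination of exact gradients plus
   centred noise. Convexity, smoothness and interpolation give
   |x - p - grad / L|^2 <= |x - p|^2 - (2 / L) (f x - min f) for the closest
   minimizer [p]. The PL inequality yields the growth f x - min f >= mu / 4 *
   dist^2, whence a contraction by the factor 1 - mu / (2 L); any growth constant
   above mu / 8 would do for the prescribed batch size [S], for which the noise
   adds at most mu eps / (4 L) and accumulates to at most eps / 2.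
   The noise is removed from the batch one sample at a time: each sample is
   independent of the sigma-algebra generated by all the others, with respect to
   which everything else is measurable, so that Tonelli's theorem on
   (Omega, that sigma-algebra) * X reduces the claim to a fixed point [x].
   For the time bound, by the time t = (S + 2 m) / (sum_(i < m) 1 / tau_i) worker
   [i] has completed more than t / tau_i - 2 useful gradients (one is lost to the
   delay, one to rounding), so the first [m] workers collect more than [S]. *)

Set Implicit Arguments.
Unset Strict Implicit.
Unset Printing Implicit Defensive.

Import Order.TTheory GRing.Theory Num.Theory.
Import numFieldNormedType.Exports.

Local Open Scope classical_set_scope.
Local Open Scope ring_scope.

(** * Euclidean inner product and norm on row vectors *)

Section Euclidean.
Context {R : realType} {d : nat}.
Implicit Types (x y z : 'rV[R]_d) (c : R).

Definition dot x y : R := \sum_(l < d) x 0 l * y 0 l.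

Lemma dotC x y : dot x y = dot y x.
Proof. by apply: eq_bigr => l _; rewrite mulrC. Qed.

Lemma dotDl x y z : dot (x + y) z = dot x z + dot y z.
Proof. by rewrite -big_split; apply: eq_bigr => l _; rewrite mxE mulrDl. Qed.

Lemma dotZl c x y : dot (c *: x) y = c * dot x y.
Proof. by rewrite mulr_sumr; apply: eq_bigr => l _; rewrite mxE mulrA. Qed.

Lemma dotNl x y : dot (- x) y = - dot x y.
Proof. by rewrite -scaleN1r dotZl mulN1r. Qed.

Lemma dotBl x y z : dot (x - y) z = dot x z - dot y z.
Proof. by rewrite dotDl dotNl. Qed.

Lemma dotDr x y z : dot x (y + z) = dot x y + dot x z.
Proof. by rewrite dotC dotDl !(dotC _ x). Qed.

Lemma dotZr c x y : dot x (c *: y) = c * dot x y.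
Proof. by rewrite dotC dotZl dotC. Qed.

Lemma dotNr x y : dot x (- y) = - dot x y.
Proof. by rewrite dotC dotNl dotC. Qed.

Lemma dotBr x y z : dot x (y - z) = dot x y - dot x z.
Proof. by rewrite dotDr dotNr. Qed.

Lemma dot0l x : dot 0 x = 0.
Proof. by rewrite -(scale0r 0) dotZl mul0r. Qed.

Lemma dot_suml (I : Type) (s : seq I) (F : I -> 'rV[R]_d) y :
  dot (\sum_(i <- s) F i) y = \sum_(i <- s) dot (F i) y.
Proof.
elim: s => [|i s IH]; first by rewrite !big_nil dot0l.
by rewrite !big_cons dotDl IH.
Qed.

Lemma dot_ge0 x : 0 <= dot x x.
Proof. by apply: sumr_ge0 => l _; rewrite -expr2 sqr_ge0. Qed.

Lemma enorm_ge0 x : 0 <= enorm x.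
Proof. exact: sqrtr_ge0. Qed.

Lemma enormE x : enorm x ^+ 2 = dot x x.
Proof.
rewrite /enorm sqr_sqrtr; last by apply: sumr_ge0 => l _; rewrite sqr_ge0.
by apply: eq_bigr => l _; rewrite expr2.
Qed.

Lemma coord_sqr_le x l : x 0 l ^+ 2 <= enorm x ^+ 2.
Proof.
rewrite enormE /dot (bigD1 l)//= expr2 lerDl.
by apply: sumr_ge0 => j _; rewrite -expr2 sqr_ge0.
Qed.

Lemma enorm_eq0 x : enorm x = 0 -> x = 0.
Proof.
move=> x0; apply/rowP => l; rewrite mxE; apply/eqP; rewrite -sqrf_eq0.
by rewrite eq_le sqr_ge0 andbT (le_trans (coord_sqr_le x l))// x0 expr0n.
Qed.

Lemma enormZ c x : enorm (c *: x) = `|c| * enorm x.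
Proof.
apply/eqP; rewrite -(@eqrXn2 _ 2)// ?mulr_ge0 ?enorm_ge0//.
by rewrite exprMn !enormE dotZl dotZr mulrA -expr2 real_normK ?num_real.
Qed.

Lemma enormN x : enorm (- x) = enorm x.
Proof. by rewrite -scaleN1r enormZ normrN1 mul1r. Qed.

Lemma enorm_sub x y : enorm (x - y) = enorm (y - x).
Proof. by rewrite -enormN opprB. Qed.

Lemma enorm0 : enorm (0 : 'rV[R]_d) = 0.
Proof. by rewrite -(scale0r 0) enormZ normr0 mul0r. Qed.

(** Expand the squared norm of [enorm y *: x - enorm x *: y], which is nonnegative, and divide by
    the product of the norms. *)
Lemma cauchy_schwarz x y : dot x y <= enorm x * enorm y.
Proof.
have [y0|y0] := eqVneq (enorm y) 0.
  by move/enorm_eq0: y0 => ->; rewrite dotC dot0l enorm0 mulr0.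
have yp : 0 < enorm y by rewrite lt_def y0 enorm_ge0.
have [x0|x0] := eqVneq (enorm x) 0.
  by move/enorm_eq0: x0 => ->; rewrite dot0l enorm0 mul0r.
have xp : 0 < enorm x by rewrite lt_def x0 enorm_ge0.
have := dot_ge0 (enorm y *: x - enorm x *: y).
rewrite dotBl !dotBr !dotZl !dotZr -!enormE (dotC y x) => h.
have {h} : 0 <= 2 * (enorm x * enorm y) * (enorm x * enorm y - dot x y) by nra.
by rewrite pmulr_rge0 ?subr_ge0// !mulr_gt0.
Qed.

Lemma enormD x y : enorm (x + y) <= enorm x + enorm y.
Proof.
rewrite -(@ler_pXn2r _ 2) ?nnegrE ?addr_ge0 ?enorm_ge0//.
rewrite enormE dotDl !dotDr -!enormE (dotC y x).
have := cauchy_schwarz x y; lra.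
Qed.

Lemma enorm_sqrB x y : enorm (x - y) ^+ 2 = enorm x ^+ 2 - 2 * dot x y + enorm y ^+ 2.
Proof. rewrite enormE dotBl !dotBr -!enormE (dotC y x); ring. Qed.

(** Jensen's inequality for the squared norm: the weighted spread of the [F i] around [v] is
    nonnegative. Total weight at most 1 is enough because the leftover multiple of [enorm v ^+ 2]
    has the right sign. *)
Lemma enorm_sqr_conv (I : Type) (s : seq I) (w : I -> R) (F : I -> 'rV[R]_d) :
  (forall i, 0 <= w i) -> \sum_(i <- s) w i <= 1 ->
  enorm (\sum_(i <- s) w i *: F i) ^+ 2 <= \sum_(i <- s) w i * enorm (F i) ^+ 2.
Proof.
move=> w0 w1; set v := \sum_(i <- s) w i *: F i.
have : 0 <= \sum_(i <- s) w i * enorm (F i - v) ^+ 2.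
  by apply: sumr_ge0 => i _; rewrite mulr_ge0 ?sqr_ge0.
have E i : w i * enorm (F i - v) ^+ 2 =
    w i * enorm (F i) ^+ 2 - 2 * dot (w i *: F i) v + w i * enorm v ^+ 2.
  by rewrite enorm_sqrB dotZl; ring.
under eq_bigr do rewrite E.
rewrite big_split /= sumrB -mulr_sumr -dot_suml -/v -mulr_suml -enormE.
have : (\sum_(i <- s) w i) * enorm v ^+ 2 <= enorm v ^+ 2.
  by rewrite ler_piMl ?sqr_ge0.
lra.
Qed.

(** With [norm_le_enorm] this makes the Euclidean and max norms equivalent, so that continuity and
    compactness transfer; the crude constant [d] suffices for that. *)
Lemma enorm_le_norm x : enorm x <= d%:R * `|x|.
Proof.
have cle l : `|x 0 l| <= `|x|.
  rewrite [leRHS]/Num.norm /= mx_normrE.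
  exact: (le_bigmax _ (fun ij => `|x ij.1 ij.2|) (0, l)).
rewrite -(@ler_pXn2r _ 2) ?nnegrE ?mulr_ge0 ?enorm_ge0//.
rewrite enormE exprMn.
apply: (@le_trans _ _ (\sum_(l < d) `|x| ^+ 2)).
  apply: ler_sum => l _; rewrite -expr2 -real_normK ?num_real//.
  by rewrite ler_pXn2r ?nnegrE.
rewrite sumr_const card_ord -[leLHS]mulr_natl ler_wpM2r ?sqr_ge0//.
by rewrite -natrX ler_nat; case: (d) => // k; rewrite -mulnn leq_pmulr.
Qed.

Lemma coord_le_enorm x l : `|x 0 l| <= enorm x.
Proof.
rewrite -(@ler_pXn2r _ 2) ?nnegrE ?enorm_ge0//.
by rewrite real_normK ?num_real// coord_sqr_le.
Qed.

Lemma norm_le_enorm x : `|x| <= enorm x.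
Proof.
rewrite [leLHS]/Num.norm /= mx_normrE; apply/bigmax_leP.
by split=> [|[i j] _]; rewrite ?enorm_ge0// (ord1 i) coord_le_enorm.
Qed.

Lemma dist_enorm x y : `|enorm x - enorm y| <= enorm (x - y).
Proof.
have h (a b : 'rV[R]_d) : enorm a - enorm b <= enorm (a - b).
  by rewrite lerBlDr -[leLHS](congr1 enorm (subrK b a)) enormD.
by rewrite ler_norml h andbT lerNl opprB (enorm_sub x) h.
Qed.

End Euclidean.

(** * First-order inequalities for smooth and convex functions *)

Section Calculus.
Context {R : realType} {d : nat}.
Implicit Types (f : 'rV[R]_d -> R) (x y p v : 'rV[R]_d).

Lemma lipschitz_continuous (f : 'rV[R]_d -> R) (K : R) :
  (forall x y, `|f x - f y| <= K * enorm (x - y)) -> continuous f.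
Proof.
move=> fK x; have Kp : 0 < `|K| * d%:R + 1 by rewrite ltr_wpDl ?mulr_ge0.
apply/(@cvgrPdist_le _ _ _ (nbhs x) (nbhs_filter x) f (f x)) => e e0.
have xe : \forall y \near x, `|x - y| <= e / (`|K| * d%:R + 1).
  apply: (@cvgr_dist_le _ _ _ (nbhs x) (nbhs_filter x) id x); first exact: cvg_id.
  by rewrite divr_gt0.
apply: filterS xe => y; rewrite ler_pdivlMr// mulrC; apply: le_trans.
apply: (le_trans (fK x y)); rewrite mulrDl mul1r -mulrA ler_wpDr//.
rewrite (le_trans (ler_wpM2r (enorm_ge0 _) (ler_norm K)))//.
by rewrite ler_wpM2l// enorm_le_norm.
Qed.

Lemma enorm_continuous v : continuous (fun x => enorm (x - v)).
Proof.
apply: (@lipschitz_continuous _ 1) => x y; rewrite mul1r.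
by rewrite (le_trans (dist_enorm _ _))// opprB addrA subrK.
Qed.

Lemma deriveE_grad f x v : differentiable f x -> 'D_v f x = dot (grad f x) v.
Proof.
move=> df; rewrite deriveE// [in LHS](row_sum_delta v) linear_sum.
by apply: eq_bigr => l _; rewrite linearZ /= mxE deriveE// mulrC.
Qed.

Lemma is_derive_line f x v (t : R) : differentiable f (x + t *: v) ->
  is_derive t 1 (fun s : R => f (x + s *: v)) (dot (grad f (x + t *: v)) v).
Proof.
move=> df.
have E : (fun h : R => h^-1 *: (((fun s : R => f (x + s *: v)) \o shift t) (h *: 1)
            - f (x + t *: v))) =
    (fun h : R => h^-1 *: ((f \o shift (x + t *: v)) (h *: v) - f (x + t *: v))).
  apply/funext => h /=; congr (_ *: (f _ - _)).
  by rewrite scalerDl addrCA [h *: 1]mulr1.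
have dv : derivable f (x + t *: v) v by exact: diff_derivable.
apply: DeriveDef; first by rewrite /derivable E.
by rewrite -(deriveE_grad _ df) /derive E.
Qed.

(** Descent lemma, by the mean value theorem on [0, 1]: from [f] along the segment subtract its
    linear part and [q] times t^2; Cauchy-Schwarz and the Lipschitz gradient make the derivative of
    the difference nonpositive. *)
Lemma smooth_le (L : R) f x y : (forall z, differentiable f z) -> smooth L f ->
  f y <= f x + dot (grad f x) (y - x) + L / 2 * enorm (y - x) ^+ 2.
Proof.
move=> df sf; set v := y - x; set c := dot (grad f x) v; set q := L / 2 * enorm v ^+ 2.
pose F : R -> R := (fun s : R => f (x + s *: v)) -
  c \*: (id : R -> R) - q \*: ((id : R -> R) ^+ 2).
pose dF t := dot (grad f (x + t *: v)) v - c *: 1 - q *: ((2 * t ^+ 1) *: 1).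
have dFE (t : R) : is_derive t 1 F (dF t).
  have d1 := is_derive_line (df (x + t *: v)).
  have d2 := is_deriveZ c (is_derive_id t (1 : R)).
  have d3 := is_deriveZ q (is_deriveX 2 (is_derive_id t (1 : R))).
  exact: is_derive_eq (is_deriveB (is_deriveB d1 d2) d3) _.
have cF : {within `[0, 1], continuous F}.
  by apply: derivable_within_continuous => t _; apply: ex_derive; exact: dFE.
have [t] := @MVT_segment _ F dF 0 1 ler01 (fun t _ => dFE t) cF.
rewrite in_itv /= => /andP[t0 _]; rewrite subr0 mulr1 => FE.
suff : dF t <= 0.
  rewrite -FE /F !fctE /= scale1r scale0r addr0 /v subrKC -/v.
  rewrite /GRing.scale /= !expr2 /c /q; lra.
rewrite /dF /GRing.scale /= !mulr1 expr1 /c -dotBl.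
have h1 := cauchy_schwarz (grad f (x + t *: v) - grad f x) v.
have := sf (x + t *: v) x.
rewrite (addrAC x) subrr add0r enormZ ger0_norm// => h2.
have := ler_wpM2r (enorm_ge0 v) h2.
rewrite /q; lra.
Qed.

(** For steps h in (0, 1], convexity bounds the difference quotient towards [y] by [f y - f x]; let
    h tend to 0 from the right. *)
Lemma convex_ge f x y : differentiable f x ->
  convex_function [set: 'rV[R]_d] f -> f x + dot (grad f x) (y - x) <= f y.
Proof.
move=> df cf; rewrite addrC -lerBrDr.
have dfv : derivable f x (y - x) by exact: diff_derivable.
rewrite -(deriveE_grad _ df); apply: (cvgr_to_le (cvg_dnbhs_at_right dfv)).
near=> h.
have h0 : 0 < h by near: h; exact: nbhs_right_gt.
have h1 : h <= 1 by near: h; exact: nbhs_right_le.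
rewrite /GRing.scale /= mulrC ler_pdivrMr// mulrC.
have h2 : f (h *: y + (1 - h) *: x) <= h * f y + (1 - h) * f x.
  exact: (cf (Itv01 (ltW h0) h1) y x (in_setT _) (in_setT _)).
rewrite (_ : h *: (y - x) + x = h *: y + (1 - h) *: x); last first.
  by rewrite scalerBr scalerBl scale1r -addrA (addrC (- _)).
rewrite (le_trans (lerB h2 (lexx _)))//; lra.
Unshelve. all: by end_near. Qed.

(** The gradient step of length 1/L decreases [f] by at least |grad|^2 / (2L), yet cannot go below
    [f p]. *)
Lemma minimizer_grad_sqr_le (L : R) f x p : 0 < L ->
  (forall z, differentiable f z) -> smooth L f -> minimizer f p ->
  enorm (grad f x) ^+ 2 <= 2 * L * (f x - f p).
Proof.
move=> L0 df sf fp; have := smooth_le x (x - L^-1 *: grad f x) df sf.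
rewrite (addrAC x) subrr add0r dotNr dotZr enormN enormZ exprMn -enormE.
have := fp (x - L^-1 *: grad f x); rewrite (ger0_norm (ltW _)) ?invr_gt0// => h1 h2.
have {h1 h2} h := le_trans h1 h2.
have E : L / 2 * (L^-1 ^+ 2 * enorm (grad f x) ^+ 2) =
    L^-1 * enorm (grad f x) ^+ 2 / 2 by field; rewrite gt_eqF.
rewrite -ler_pdivrMl ?mulr_gt0// invfM; move: h; rewrite E; lra.
Qed.

Lemma minimizer_grad0 (L : R) f p : 0 < L ->
  (forall z, differentiable f z) -> smooth L f -> minimizer f p -> grad f p = 0.
Proof.
move=> L0 df sf fp; apply: enorm_eq0; apply/eqP; rewrite -sqrf_eq0 eq_le sqr_ge0.
by rewrite (le_trans (minimizer_grad_sqr_le p L0 df sf fp))// subrr mulr0.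
Qed.

Lemma dot_grad_ge (L : R) f x p : 0 < L ->
  (forall z, differentiable f z) -> smooth L f ->
  convex_function [set: 'rV[R]_d] f -> minimizer f p ->
  f x - f p + enorm (grad f x) ^+ 2 / (2 * L) <= dot (grad f x) (x - p).
Proof.
(* Compare the quadratic upper bound at [p] and the linear lower bound at [x]
   in the point [p + grad f x / L]. *)
move=> L0 df sf cf fp; set z := p + L^-1 *: grad f x.
have := smooth_le p z df sf.
rewrite (minimizer_grad0 L0 df sf fp) dot0l addr0 /z (addrAC p) subrr add0r enormZ.
rewrite exprMn (ger0_norm (ltW _)) ?invr_gt0// -/z => h1.
have := convex_ge z (df x) cf.
have -> : z - x = L^-1 *: grad f x + (p - x) by rewrite /z addrAC addrC.
rewrite (dotDr _ (_ *: _)) dotZr -enormE => h2.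
have E1 : L / 2 * (L^-1 ^+ 2 * enorm (grad f x) ^+ 2) =
    L^-1 * enorm (grad f x) ^+ 2 / 2 by field; rewrite gt_eqF.
have E2 : enorm (grad f x) ^+ 2 / (2 * L) = L^-1 * enorm (grad f x) ^+ 2 / 2.
  by field; rewrite gt_eqF.
rewrite -(opprB p x) dotNr E2; move: h1 h2; rewrite E1; lra.
Qed.

End Calculus.

(** * Existence of minimizers, projection onto their set, quadratic growth *)

Section Minimizers.
Context {R : realType} {d : nat}.
Implicit Types (f : 'rV[R]_d -> R) (x y p q : 'rV[R]_d).

(** Outside the ball of radius [h x1 / a] around [x], [h] exceeds [h x1], so it is enough to
    minimize over the compact part of [C] inside that ball. This serves both the projection and
    quadratic growth. *)
Lemma coercive_argmin (C : set 'rV[R]_d) (h : 'rV[R]_d -> R) (a : R) x x1 :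
  0 < a -> closed C -> continuous h -> C x1 ->
  (forall y, C y -> a * enorm (y - x) <= h y) ->
  exists2 p, C p & forall q, C q -> h p <= h q.
Proof.
move=> a0 Ccl hc Cx1 ha.
pose K := C `&` (fun y => enorm (y - x)) @^-1` [set r | r <= h x1 / a].
have Kx1 : K x1 by split => //=; rewrite ler_pdivlMr// mulrC ha.
have Kcpt : compact K.
  apply: bounded_closed_compact.
    exists (h x1 / a + `|x|); split; first exact: num_real.
    move=> M ltM y [_ /= yx]; apply: le_trans (ltW ltM).
    rewrite -[in leLHS](subrK x y) (le_trans (ler_normD _ _))// lerD2r.
    by rewrite (le_trans (norm_le_enorm _)).
  apply: closedI => //; apply: preimage_closed; last exact: closed_le.
  by move=> z _; exact: enorm_continuous.
have [p] := compact_EVT_min (ex_intro _ x1 Kx1) Kcpt (continuous_subspaceT hc).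
rewrite inE => -[Cp px] hp; exists p => // q Cq.
have [qx|qx] := leP (enorm (q - x)) (h x1 / a); first by apply: hp; rewrite inE.
have x1q : h x1 < h q.
  by rewrite (lt_le_trans _ (ha q Cq))// mulrC -ltr_pdivrMr.
by rewrite (le_trans _ (ltW x1q))// hp// inE.
Qed.

Lemma closed_minimizer f : continuous f -> closed [set p | minimizer f p].
Proof.
move=> fc; rewrite (_ : [set p | _] = \bigcap_y (f @^-1` [set r | r <= f y])).
  apply: closed_bigI => y _; apply: preimage_closed; last exact: closed_le.
  by move=> z _; exact: fc.
by apply/seteqP; split=> [p fp y _|p fp y]; [exact: fp|exact: (fp y I)].
Qed.

(** The distance to [x] is itself coercive with constant 1, so the default value of [xget] is never
    taken. *)
Lemma closest_minimizerP f x p : continuous f -> minimizer f p ->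
  minimizer f (closest_minimizer f x) /\
  forall q, minimizer f q -> enorm (x - closest_minimizer f x) <= enorm (x - q).
Proof.
move=> fc fp; rewrite /closest_minimizer.
have [y|z fz zmin] := @coercive_argmin _ (fun y => enorm (y - x)) 1 x p ltr01
  (closed_minimizer fc) (@enorm_continuous _ _ x) fp; first by rewrite mul1r.
apply: (@xgetPex _ 0 [set z | minimizer f z /\
  forall q, minimizer f q -> enorm (x - z) <= enorm (x - q)]).
by exists z; split=> // q /zmin; rewrite !(enorm_sub x).
Qed.

Lemma closest_minimizer_eq f h : (forall x, minimizer f x <-> minimizer h x) ->
  closest_minimizer f = closest_minimizer h.
Proof.
move=> fh; have mfh : minimizer f = minimizer h by apply/funext => x; exact/propext.
by apply/funext => x; rewrite /closest_minimizer mfh.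
Qed.

Lemma minimizer_convex f p q (t : R) : convex_function [set: 'rV[R]_d] f ->
  minimizer f p -> minimizer f q -> 0 <= t -> t <= 1 ->
  minimizer f (p + t *: (q - p)).
Proof.
move=> cf fp fq t0 t1 y; apply: le_trans (fp y).
have h : f (t *: q + (1 - t) *: p) <= t * f q + (1 - t) * f p.
  exact: (cf (Itv01 t0 t1) q p (in_setT _) (in_setT _)).
rewrite (_ : p + _ = t *: q + (1 - t) *: p); last first.
  by rewrite scalerBr scalerBl scale1r addrCA.
rewrite (le_trans h)//; have := fq p; nra.
Qed.

(** Obtuse angle property of a projection. If the product [a] were positive, moving from the
    projection towards [q] by the fraction t = a / (a + b) would change the squared distance by t (t
    b - 2 a) < 0. *)
Lemma closest_minimizer_dot_le0 f x q : continuous f ->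
  convex_function [set: 'rV[R]_d] f -> minimizer f q ->
  dot (x - closest_minimizer f x) (q - closest_minimizer f x) <= 0.
Proof.
move=> fc cf fq; have [] := closest_minimizerP x fc fq.
set p := closest_minimizer f x => fp pmin.
set a := dot _ _; rewrite leNgt; apply/negP => a0.
set b := enorm (q - p) ^+ 2; have b0 : 0 <= b by exact: sqr_ge0.
have ab : 0 < a + b by rewrite ltr_wpDr.
have t0 : 0 <= a / (a + b) by rewrite divr_ge0// ltW.
have t1 : a / (a + b) <= 1 by rewrite ler_pdivrMr// mul1r lerDl.
have := pmin _ (minimizer_convex cf fp fq t0 t1).
rewrite -(@ler_pXn2r _ 2) ?nnegrE ?enorm_ge0// opprD addrA.
rewrite (enorm_sqrB (x - p)) dotZr enormZ exprMn real_normK ?num_real// -/a -/b.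
have E : a / (a + b) * (a + b) = a by rewrite divfK// gt_eqF.
move: (a / (a + b)) t0 t1 E => t t0 t1 E.
have t_gt0 : 0 < t by rewrite lt_def t0 andbT; apply: contraTneq a0 => tE; rewrite -E tE mul0r ltxx.
nra.
Qed.

(** Adding the obtuse angle inequalities at both projections gives |u - v|^2 <= (x - y) . (u - v);
    conclude by Cauchy-Schwarz. The Lipschitz bound later makes the projection of a random iterate
    measurable. *)
Lemma closest_minimizer_nonexpansive f x y p : continuous f ->
  convex_function [set: 'rV[R]_d] f -> minimizer f p ->
  enorm (closest_minimizer f x - closest_minimizer f y) <= enorm (x - y).
Proof.
move=> fc cf fp.
have [fx _] := closest_minimizerP x fc fp; have [fy _] := closest_minimizerP y fc fp.
have := closest_minimizer_dot_le0 x fc cf fy; have := closest_minimizer_dot_le0 y fc cf fx.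
set u := closest_minimizer f x; set v := closest_minimizer f y => h1 h2.
have h3 := cauchy_schwarz (x - y) (u - v).
have h4 : enorm (u - v) ^+ 2 <= dot (x - y) (u - v).
  rewrite enormE; move: h1 h2; rewrite -(opprB u v) dotNr !dotBl; lra.
have [->|uv] := eqVneq (enorm (u - v)) 0; first exact: enorm_ge0.
have uv0 : 0 < enorm (u - v) by rewrite lt_def uv enorm_ge0.
by rewrite -(ler_pM2r uv0) -expr2 (le_trans h4).
Qed.

(* The point [y] minimises [sqrt (f y - f p) + sqrt mu / 2 * |y - x|]: were its
   gradient nonzero, the gradient step [y - grad f y / (2 L)] would do better. *)
Lemma quadratic_growth (L mu : R) f x p : 0 < L -> 0 < mu ->
  (forall z, differentiable f z) -> smooth L f -> minimizer f p ->
  (forall z, 2 * mu * (f z - f p) <= enorm (grad f z) ^+ 2) ->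
  exists2 y, minimizer f y & mu / 4 * enorm (x - y) ^+ 2 <= f x - f p.
Proof.
move=> L0 mu0 df sf fp PL.
have fc : continuous f by move=> z; exact: differentiable_continuous.
have [c c0 c2] : exists2 c : R, 0 < c & c ^+ 2 = mu / 4.
  exists (Num.sqrt (mu / 4)); first by rewrite sqrtr_gt0 divr_gt0.
  by rewrite sqr_sqrtr// ltW// divr_gt0.
pose s y := Num.sqrt (f y - f p).
have s0 y : 0 <= s y by exact: sqrtr_ge0.
have s2 y : s y ^+ 2 = f y - f p by rewrite sqr_sqrtr// subr_ge0 fp.
pose h y := s y + c * enorm (y - x).
have hc : continuous h.
  move=> z; have h1 : {for z, continuous (fun y => c * enorm (y - x))}.
    exact: (cvgM (cvg_cst c) (@enorm_continuous R d x z)).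
  have h2 : {for z, continuous (fun y => f y - f p)}.
    exact: (cvgB (fc z) (cvg_cst (f p))).
  have h3 : {for z, continuous s} := continuous_comp h2 (@sqrt_continuous R _).
  exact: (cvgD h3 h1).
have [|y _ ymin] := @coercive_argmin setT h c x x c0 closedT hc I.
  by move=> y _; rewrite lerDr.
set G := enorm (grad f y); have G0 : 0 <= G by exact: enorm_ge0.
have Gy : G = 0.
  apply/eqP; apply: contraT => Gn0; have Gp : 0 < G by rewrite lt_def Gn0.
  set z := y - (2 * L)^-1 *: grad f y.
  have zy : z - y = - ((2 * L)^-1 *: grad f y) by rewrite /z addrAC subrr add0r.
  have L2 : 0 < (2 * L)^-1 by rewrite invr_gt0 mulr_gt0.
  have := smooth_le y z df sf; rewrite zy dotNr dotZr enormN enormZ -enormE exprMn -/G.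
  rewrite (gtr0_norm L2) => fz.
  (* The step 1 / (2L) gains 1/2 from the linear term and loses 1/8 to the quadratic one, in units
     of G^2 / L. *)
  have {fz} fz : s z ^+ 2 <= s y ^+ 2 - 3 / 8 * L^-1 * G ^+ 2.
    rewrite !s2; rewrite (_ : L / 2 * _ = L^-1 / 8 * G ^+ 2) in fz; last first.
      by field; rewrite gt_eqF.
    rewrite (_ : (2 * L)^-1 = L^-1 / 2) in fz; last by field; rewrite gt_eqF.
    lra.
  have hyz := ymin z I; rewrite /h in hyz.
  have zx : enorm (z - x) <= enorm (y - x) + L^-1 / 2 * G.
    have -> : z - x = (y - x) + (z - y) by rewrite [RHS]addrC addrA subrK.
    rewrite (le_trans (enormD _ _))// lerD2l zy enormN enormZ.
    by rewrite (gtr0_norm L2) -/G invfM (mulrC 2^-1).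
  have {hyz zx} sz : s y - s z <= c * (L^-1 / 2 * G).
    have := ler_wpM2l (ltW c0) zx; rewrite mulrDr; lra.
  have Li : 0 < L^-1 by rewrite invr_gt0.
  have szy : s z <= s y.
    rewrite -(@ler_pXn2r _ 2) ?nnegrE// (le_trans fz)// gerBl.
    by rewrite !mulr_ge0// ltW.
  have h1 : 3 / 8 * L^-1 * G ^+ 2 <= c * (L^-1 / 2 * G) * (2 * s y).
    have : (s y - s z) * (s y + s z) <= c * (L^-1 / 2 * G) * (2 * s y).
      apply: ler_pM; rewrite ?subr_ge0 ?addr_ge0//.
      by rewrite mulrDl mul1r lerD2l.
    by rewrite -subr_sqr; lra.
  have h2 : 3 / 8 * G <= c * s y.
    rewrite -(ler_pM2l (mulr_gt0 Li Gp)).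
    by move: h1; rewrite expr2; lra.
  have h3 : 2 * mu * s y ^+ 2 <= G ^+ 2 by rewrite s2; exact: PL.
  (* Contradiction between constants: [h2] gives 9/64 G^2 <= mu/4 s(y)^2, whereas PL bounds the
     right side by G^2 / 8 = 8/64 G^2. *)
  have : (3 / 8 * G) ^+ 2 <= (c * s y) ^+ 2.
    by rewrite ler_pXn2r ?nnegrE ?mulr_ge0// ltW.
  rewrite !exprMn c2 => h4.
  have : 0 < G ^+ 2 by rewrite exprn_gt0.
  by lra.
(* A zero gradient forces the PL gap at [y] to vanish. The growth bound is then [h y <= h x], as
   [h x = s x]. *)
have fy : minimizer f y.
  have := PL y; rewrite -/G Gy expr0n /= => fyp z; rewrite (le_trans _ (fp z))//.
  by rewrite -subr_le0 -(pmulr_rle0 _ (mulr_gt0 (ltr0n _ 2) mu0)).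
exists y => //; rewrite -c2 -exprMn -s2 ler_pXn2r ?nnegrE ?mulr_ge0 ?enorm_ge0 ?(ltW c0)//.
have := ymin x I; rewrite /h subrr enorm0 mulr0 addr0 enorm_sub; apply: le_trans.
by rewrite lerDr.
Qed.

End Minimizers.

(** * Contraction of the noiseless step *)

Section Contraction.
Context {R : realType} {d : nat}.
Implicit Types (f : 'rV[R]_d -> R) (x p : 'rV[R]_d).

Lemma inf_minimizer f p : minimizer f p -> inf (range f) = f p.
Proof.
move=> fp; apply/eqP; rewrite eq_le; apply/andP; split.
  by apply: ge_inf; [exists (f p) => _ [y _ <-]; exact: fp|exists p].
by apply: lb_le_inf; [exists (f p), p|move=> _ [y _ <-]; exact: fp].
Qed.

(** The weights are arbitrary because a batch need not represent the workers equally. Common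
    minimizers let every summand be compared with the same [p]; in the expanded square, the gradient
    term of [dot_grad_ge] cancels |v|^2 / L^2 by Jensen, leaving only growth. *)
Lemma gradient_step_contraction (I : Type) (s : seq I) (w : I -> R)
    (f : I -> 'rV[R]_d -> R) (f0 : 'rV[R]_d -> R) (L mu : R) x p0 :
  0 < L -> 0 < mu -> continuous f0 ->
  (forall i z, differentiable (f i) z) -> (forall i, smooth L (f i)) ->
  (forall i, convex_function [set: 'rV[R]_d] (f i)) ->
  (forall i, local_PL mu (f i)) ->
  (forall i z, minimizer f0 z <-> minimizer (f i) z) -> minimizer f0 p0 ->
  (forall i, 0 <= w i) -> \sum_(i <- s) w i = 1 ->
  enorm (x - closest_minimizer f0 x - L^-1 *: \sum_(i <- s) w i *: grad (f i) x) ^+ 2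
    <= (1 - mu / (2 * L)) * enorm (x - closest_minimizer f0 x) ^+ 2.
Proof.
move=> L0 mu0 f0c df sf cf PL f0f f0p w0 w1.
have [] := closest_minimizerP x f0c f0p; set p := closest_minimizer f0 x => fp pmin.
set v := \sum_(i <- s) _; set D := enorm (x - p) ^+ 2.
have Li : 0 < L^-1 by rewrite invr_gt0.
have growth i : mu / 4 * D <= f i x - f i p.
  have [|y fy] := quadratic_growth x L0 mu0 (df i) (sf i) ((f0f i p).1 fp).
    by have [_] := PL i; rewrite (inf_minimizer ((f0f i p).1 fp)).
  apply: le_trans; rewrite ler_wpM2l ?divr_ge0 ?(ltW mu0)//.
  by rewrite ler_pXn2r ?nnegrE ?enorm_ge0// pmin//; apply/f0f; exact: fy.
have v2 : enorm v ^+ 2 <= \sum_(i <- s) w i * enorm (grad (f i) x) ^+ 2.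
  by apply: enorm_sqr_conv; rewrite ?w1.
have vd : \sum_(i <- s) w i * (mu / 4 * D + enorm (grad (f i) x) ^+ 2 / (2 * L)) <=
    dot (x - p) v.
  rewrite dotC dot_suml; apply: ler_sum => i _; rewrite dotZl ler_wpM2l//.
  rewrite (le_trans _ (dot_grad_ge x L0 (df i) (sf i) (cf i) ((f0f i p).1 fp)))//.
  by rewrite lerD2r.
set V := \sum_(i <- s) w i * enorm (grad (f i) x) ^+ 2 in v2.
have {}vd : mu / 4 * D + V / (2 * L) <= dot (x - p) v.
  have E a b (G : I -> R) :
      \sum_(i <- s) w i * (a + G i / b) = a + (\sum_(i <- s) w i * G i) / b.
    under eq_bigr do rewrite mulrDr mulrA.
    by rewrite big_split /= -!mulr_suml w1 mul1r.
  by rewrite E in vd.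
rewrite enorm_sqrB dotZr enormZ exprMn (gtr0_norm Li) -/D.
have h1 := ler_wpM2l (ltW Li) vd.
have h2 := ler_wpM2l (sqr_ge0 L^-1) v2.
have E1 : (2 * L)^-1 = L^-1 / 2 by rewrite invfM mulrC.
rewrite E1 in h1; rewrite E1.
lra.
Qed.

End Contraction.

(** * Duration of one collection phase *)

Section CollectionTime.
Context {R : realType} {n : nat}.

Lemma stop_time_le (S : R) (tau : 'I_n -> R) (r : 'I_n -> \bar R)
    (h : 'I_n -> nat -> \bar R) (m : nat) :
  (0 < m <= n)%N -> 0 <= S -> (forall i, 0 < tau i) ->
  (forall i, (r i <= (tau i)%:E)%E) -> (forall i j, (h i j <= (tau i)%:E)%E) ->
  (stop_time S (finish_time r h) <=
    ((S + 2 * m%:R) / \sum_(i < n | (i < m)%N) (tau i)^-1)%:E)%E.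
Proof.
move=> /andP[m0 mn] S0 tau0 rtau htau.
have n0 : (0 < n)%N by exact: leq_trans mn.
have hasm : has (fun i : 'I_n => (i < m)%N) (index_enum 'I_n).
  by apply/hasP; exists (Ordinal n0); rewrite ?mem_index_enum.
set H := \sum_(i < n | _) _.
have H0 : 0 < H.
  rewrite (_ : 0 = \sum_(i < n | (i < m)%N) 0); last by rewrite big1.
  by apply: ltr_sum => // i _; rewrite invr_gt0.
set t := (S + 2 * m%:R) / H.
have t0 : 0 <= t by rewrite divr_ge0 ?addr_ge0 ?mulr_ge0 ?(ltW H0).
apply: ereal_inf_lbound.
(* The predecessor reserves one [tau i] for the delay, so gradient number [j] (from 0) ends by
   [j.+2] times [tau i]. The count exceeds t / tau_i - 2 even when the truncation is 0, and these
   lower bounds sum to exactly [S]. *)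
exists (fun i : 'I_n => if (i < m)%N then (Num.truncn (t / tau i)).-1 else 0%N); split.
  rewrite natr_sum (bigID (fun i : 'I_n => (i < m)%N))/= [X in _ + X]big1 ?addr0; last first.
    by move=> i /negbTE ->.
  have -> : S = \sum_(i < n | (i < m)%N) (t / tau i - 2).
    rewrite sumrB -mulr_sumr -/H /t divfK ?gt_eqF//.
    rewrite -(big_ord_widen n (fun=> 2) mn) sumr_const card_ord.
    by rewrite -(mulr_natr 2 m) addrK.
  apply: ltr_sum => // i ->.
  have := truncnS_gt (t / tau i).
  case: (Num.truncn _) => [|k] /=; rewrite -?natr1; lra.
move=> i j; case: ifP => // im jB.
have jt : (j.+2 <= Num.truncn (t / tau i))%N by move: jB; case: (Num.truncn _).
have {}jt : j.+2%:R * tau i <= t.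
  rewrite -ler_pdivlMr// (le_trans _ (_ : (Num.truncn (t / tau i))%:R <= _))//.
    by rewrite ler_nat.
  by rewrite truncn_le divr_ge0// ltW.
apply: (@le_trans _ _ (j.+2%:R * tau i)%:E); last by rewrite lee_fin.
rewrite /finish_time -natr1 mulrDl mul1r addrC EFinD leeD//.
apply: (@le_trans _ _ (\sum_(l < j.+1) (tau i)%:E)%E); first exact: lee_sum.
by rewrite sumEFin lee_fin sumr_const card_ord mulr_natl.
Qed.

End CollectionTime.

(** * Measurability of random vectors *)

Section CoordMeasurable.
Context {R : realType} {d : nat} {dT : measure_display} {T : measurableType dT}.
Implicit Types (X Y : T -> 'rV[R]_d) (h : 'rV[R]_d -> R).

(** Borel measurability into R^d, stated by coordinates. The source [T] is kept general so that it
    can be Omega with a smaller sigma-algebra. *)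
Definition coord_measurable X : Prop :=
  forall l, measurable_fun [set: T] (fun t => X t 0 l).

Lemma coord_measurable_cst x : coord_measurable (fun=> x).
Proof. by move=> l; exact: measurable_cst. Qed.

Lemma coord_measurableD X Y : coord_measurable X -> coord_measurable Y ->
  coord_measurable (fun t => X t + Y t).
Proof.
move=> mX mY l; under eq_fun do rewrite mxE.
exact: measurable_funD (mX l) (mY l).
Qed.

Lemma coord_measurableZ (c : R) X : coord_measurable X ->
  coord_measurable (fun t => c *: X t).
Proof.
move=> mX l; under eq_fun do rewrite mxE.
exact: measurable_funM (measurable_cst c) (mX l).
Qed.

Lemma coord_measurableB X Y : coord_measurable X -> coord_measurable Y ->
  coord_measurable (fun t => X t - Y t).
Proof.
move=> mX mY; apply: coord_measurableD mX _.
under eq_fun do rewrite -scaleN1r.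
exact: coord_measurableZ mY.
Qed.

Lemma coord_measurable_sum (I : Type) (s : seq I) (F : I -> T -> 'rV[R]_d) :
  (forall i, coord_measurable (F i)) ->
  coord_measurable (fun t => \sum_(i <- s) F i t).
Proof.
move=> mF l; under eq_fun do rewrite summxE.
by apply: measurable_sum => i; exact: mF.
Qed.

(* A superlevel set of [h] is the union of the rational boxes that it contains. *)
Lemma continuous_coord_measurable h X : continuous h -> coord_measurable X ->
  measurable_fun [set: T] (fun t => h (X t)).
Proof.
move=> hc mX _; apply: (measurability _ (RGenOInfty.measurableE R)) => //.
move=> _ [_ [a ->] <-]; rewrite setTI.
pose box (c : 'rV[rat]_d * nat) : set 'rV[R]_d :=
  [set x | forall l, `|x 0 l - ratr (c.1 0 l)| < c.2.+1%:R^-1].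
pose boxes := [set c | forall x, box c x -> a < h x].
have -> : (fun t => h (X t)) @^-1` `]a, +oo[%classic =
    \bigcup_c (if c \in boxes then X @^-1` box c else set0).
  apply/seteqP; split=> t /=; rewrite in_itv/= andbT; last first.
    by case=> c _; case: ifPn => //; rewrite inE => bc /bc.
  move=> ahX.
  have /hc/nbhs_ballP[e e0 he] : nbhs (h (X t)) [set r | a < r].
    by apply: lt_nbhsr.
  have [k ke] : exists k, k.+1%:R^-1 < e / 2 :> R.
    by have [k _ /(_ k (leqnn k))] := near_infty_natSinv_lt (PosNum (divr_gt0 e0 (ltr0n R 2)));
      exists k.
  (* Round the coordinates of [X t] to rationals within 1 / (k + 1) < e / 2; the box around the
     rounded point then lies in the ball of radius [e] about [X t]. *)
  have /choice[q qX] : forall l, exists q : rat, `|X t 0 l - ratr q| < k.+1%:R^-1 :> R.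
    move=> l; have : X t 0 l - k.+1%:R^-1 < X t 0 l + k.+1%:R^-1.
      by rewrite ltrBlDr -addrA ltrDl addr_gt0.
    move=> /rat_in_itvoo[q]; rewrite in_itv/= => /andP[q1 q2]; exists q.
    by rewrite ltr_distl ltrBlDr q2 -ltrBlDr q1.
  exists (\row_l q l, k) => //; case: ifPn => [_ l /=|]; first by rewrite mxE.
  rewrite notin_setE; apply: contra_notP => _ x bx; apply: he.
  split=> // i l; rewrite (ord1 i) /ball/=.
  have := bx l; rewrite /= mxE distrC => h1; have := qX l => h2.
  rewrite -(subrK (ratr (q l)) (X t 0 l)) -addrA (le_lt_trans (ler_normD _ _))//.
  by rewrite (lt_trans (ltrD h2 h1))// (splitr e) ltrD.
apply: countable_bigcupT_measurable => // c; case: ifPn => // _.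
rewrite (_ : X @^-1` box c = \bigcap_(l in [set: 'I_d])
    ((fun t => X t 0 l) @^-1` `](ratr (c.1 0 l) - c.2.+1%:R^-1),
                                (ratr (c.1 0 l) + c.2.+1%:R^-1)[%classic)).
  apply: fin_bigcap_measurable => // l _.
  by rewrite -[X in measurable X]setTI; apply: mX => //; exact: measurable_itv.
apply/seteqP; split=> t bt l; first by move=> _; rewrite /= in_itv/= -ltr_distl bt.
by have := bt l I; rewrite /= in_itv/= -ltr_distl.
Qed.

End CoordMeasurable.

(** * Independence of one sample from all the others *)

Section Independence.
Context {R : realType} {dO : measure_display} {Omega : measurableType dO}
  (P : probability Omega R).

Section OtherSamples.
Context {I : choiceType} {dT : I -> measure_display}
  {T : forall e, measurableType (dT e)} (Y : forall e, Omega -> T e) (e0 : I).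

(* A pi-system generating the sigma-algebra of the [Y e] with [e != e0]. *)
Definition other_cylinders : set (set Omega) :=
  [set E | exists (s : seq I) (A : forall e, set (T e)),
    [/\ uniq s, e0 \notin s, forall e, measurable (A e),
        forall e, e \notin s -> A e = setT &
        E = \bigcap_(e in [set` s]) (Y e @^-1` A e)]].

Hypothesis mY : forall e, measurable_fun [set: Omega] (Y e).

Lemma other_cylinders_measurable : other_cylinders `<=` measurable.
Proof.
move=> _ [s [A [_ _ mA _ ->]]]; apply: fin_bigcap_measurable => // e _.
by rewrite -[X in measurable X]setTI; exact: mY.
Qed.

Lemma other_cylinders_setI : setI_closed other_cylinders.
Proof.
move=> _ _ [s [A [us es mA AT ->]]] [t [B [ut et mB BT ->]]].
exists (undup (s ++ t)), (fun e => A e `&` B e); split.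
- exact: undup_uniq.
- by rewrite mem_undup mem_cat negb_or es.
- by move=> e; exact: measurableI.
- by move=> e; rewrite mem_undup mem_cat negb_or => /andP[/AT -> /BT ->]; rewrite setIT.
apply/seteqP; split=> w /=.
  move=> [ws wt] e _; split.
    by have [/ws//|/AT ->] := boolP (e \in s).
  by have [/wt//|/BT ->] := boolP (e \in t).
by move=> wst; split=> e /= es'; have := wst e;
  rewrite /= mem_undup mem_cat es' ?orbT => /(_ isT)[].
Qed.

Lemma measurable_other_sample e : e != e0 ->
  measurable_fun [set: g_sigma_algebraType other_cylinders] (Y e).
Proof.
move=> ee0 _ A mA; rewrite setTI; apply: sub_sigma_algebra.
exists [:: e], (dfwith (fun e' => [set: T e']) e A); split=> //.
- by rewrite inE eq_sym.
- by move=> e'; case: dfwithP.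
- by move=> e'; rewrite inE => ne; rewrite dfwithout// eq_sym.
apply/seteqP; split=> w /=; last by move=> /(_ e); rewrite /= mem_head dfwithin => /(_ isT).
by move=> Aw e' /=; rewrite inE => /eqP ->; rewrite dfwithin.
Qed.

(** As functions of [E], both sides are finite measures, so agreement on the pi-system of cylinders
    suffices. *)
Lemma other_samples_independent : mutually_independent P Y ->
  forall (E : set Omega) (B : set (T e0)), <<s other_cylinders >> E -> measurable B ->
  P (E `&` Y e0 @^-1` B) = (P E * P (Y e0 @^-1` B))%E.
Proof.
move=> ind E B mE mB.
have mYB : measurable (Y e0 @^-1` B) by rewrite -[X in measurable X]setTI; exact: mY.
have PB0 : 0 <= fine (P (Y e0 @^-1` B)) by exact: fine_ge0.
pose m1 : {measure set Omega -> \bar R} := mrestr P mYB.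
pose m2 : {measure set Omega -> \bar R} := mscale (NngNum PB0) P.
have m2E A : m2 A = (P A * P (Y e0 @^-1` B))%E.
  by rewrite /m2 /= /mscale /= fineK ?fin_num_measure// muleC.
rewrite -m2E -[LHS]/(m1 E).
apply: (g_sigma_algebra_measure_unique other_cylinders _ (fun=> setT)) => //.
- exact: other_cylinders_measurable.
- move=> _; exists [::], (fun=> setT); split=> //.
  by rewrite set_nil bigcap_set0.
- by rewrite bigcup_const//; exists 0%N.
- exact: other_cylinders_setI.
- move=> _ [s [A [us es mA AT ->]]].
  (* Inserting [B] at [e0] turns the intersection into a cylinder over [e0 :: s], to which mutual
     independence applies. *)
  pose A' := dfwith A e0 B.
  have mA' e : measurable (A' e) by rewrite /A'; case: dfwithP.
  have A'E e : e \in s -> A' e = A e.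
    by move=> ie; rewrite /A' dfwithout//; apply: contraNneq es => ->.
  have := ind (e0 :: s) A'; rewrite /= es us big_cons /A' dfwithin -/A' => /(_ isT mA').
  have -> : (\prod_(e <- s) P (Y e @^-1` A' e) = \prod_(e <- s) P (Y e @^-1` A e))%E.
    by rewrite big_seq [RHS]big_seq; apply: eq_bigr => e /A'E ->.
  rewrite m2E (ind s A us mA) muleC => <-; congr (P _).
  apply/seteqP; split=> w /=.
    move=> [wA wB] e /=; rewrite inE => /orP[/eqP ->|es']; first by rewrite /A' dfwithin.
    by rewrite A'E//; exact: wA.
  move=> wA; split; last by have := wA e0; rewrite /= mem_head /A' dfwithin => /(_ isT).
  by move=> e es'; rewrite -A'E//; apply: wA; rewrite /= inE es' orbT.
- by move=> _; rewrite /m1 /= /mrestr setTI -ge0_fin_numE// fin_num_measure.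
Qed.

End OtherSamples.

(** The factorization on rectangles identifies the joint law with the product measure; Tonelli then
    splits the integral. *)
Lemma integral_independent {dU dX : measure_display} (U : measurableType dU)
    (X : measurableType dX) (D : probability X R)
    (u : {mfun Omega >-> U}) (v : {mfun Omega >-> X}) (phi : U * X -> \bar R) :
  (forall A B, measurable A -> measurable B ->
    P (u @^-1` A `&` v @^-1` B) = (P (u @^-1` A) * D B)%E) ->
  measurable_fun setT phi -> (forall z, 0 <= phi z)%E ->
  (\int[P]_w phi (u w, v w) =
   \int[distribution P u]_y \int[D]_s phi (y, s))%E.
Proof.
move=> ind mphi phi0.
have muv : measurable_fun [set: Omega] (fun w => (u w, v w)).
  exact: measurable_fun_pair.
rewrite -(fubini_tonelli1 (m1 := distribution P u) (m2 := D))//.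
transitivity (\int[pushforward P (fun w => (u w, v w))]_z phi z)%E.
  by rewrite ge0_integral_pushforward.
apply: eq_measure_integral => A mA _; apply/esym.
apply: (product_measure_unique (m1 := distribution P u) (m2 := D)
  (m' := pushforward P (fun w => (u w, v w)))) => // B C mB mC.
Qed.

End Independence.

(** * Second moment of centred noise at a fixed point *)

Section Noise.
Context {R : realType} {d : nat} {dX : measure_display} {X : measurableType dX}.
Implicit Types (D : probability X R) (u : X -> 'rV[R]_d).

Lemma measurable_enorm_sqr {dT : measure_display} {T : measurableType dT}
    (Y : T -> 'rV[R]_d) : coord_measurable Y ->
  measurable_fun [set: T] (fun t => enorm (Y t) ^+ 2).
Proof.
move=> mY; under eq_fun do rewrite enormE.
by apply: measurable_sum => l; apply: measurable_funM; exact: mY.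
Qed.

(** In the expanded square the cross term has mean zero by unbiasedness. Most of the work is
    integrability, which must precede splitting the integral. *)
Lemma noise_second_moment D u (G a : 'rV[R]_d) (c s2 : R) :
  coord_measurable u ->
  (forall l, 'E_D[fun s => (u s 0 l)%R] = (G 0 l)%:E)%E ->
  ('E_D[fun s => (enorm (u s - G) ^+ 2)%R] <= s2%:E)%E ->
  (\int[D]_s (enorm (a - c *: (u s - G)) ^+ 2)%:E <=
   (enorm a ^+ 2 + c ^+ 2 * s2)%:E)%E.
Proof.
rewrite unlock => mu Eu Eu2; pose h s := u s - G.
have icst (r : R) : D.-integrable setT (fun=> r%:E).
  exact: finite_measure_integrable_cst.
have Icst (r : R) : (\int[D]_s r%:E = r%:E)%E.
  by rewrite integral_cst// [X in (_ * X)%E]probability_setT mule1.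
have mh : coord_measurable h by exact: coord_measurableB mu (coord_measurable_cst G).
have iN : D.-integrable setT (fun s => (enorm (h s) ^+ 2)%:E).
  apply/integrableP; split; first exact/measurable_EFinP/measurable_enorm_sqr.
  rewrite (le_lt_trans _ (ltry s2))// (le_trans _ Eu2)//.
  rewrite le_eqVlt; apply/orP; left; apply/eqP/eq_integral => s _.
  by rewrite /= ger0_norm ?sqr_ge0.
(* Dominate |h_l| by 1 + |h|^2, which is integrable by the variance bound. *)
have ih l : D.-integrable setT (fun s => (h s 0 l)%:E).
  apply: le_integrable (integrableD _ (icst 1) iN) => //.
    exact/measurable_EFinP/mh.
  move=> s _; rewrite -EFinD !abse_EFin lee_fin [leRHS]ger0_norm ?addr_ge0 ?sqr_ge0//.
  have := coord_sqr_le (h s) l; have := sqr_ge0 (`|h s 0 l| - 1).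
  rewrite sqrrB1 real_normK ?num_real// mulr2n; have := sqr_ge0 (h s 0 l); lra.
have Eh l : (\int[D]_s (h s 0 l)%:E = 0)%E.
  have := Eu l; rewrite (eq_integral (fun s => ((h s 0 l)%:E + (G 0 l)%:E)%E)); last first.
    by move=> s _; rewrite -EFinD /h !mxE subrK.
  rewrite integralD// Icst => /eqP.
  rewrite -(fineK (integrable_fin_num measurableT (ih l))) -EFinD eqe.
  by rewrite addrC -subr_eq0 addrAC subrr add0r => /eqP ->.
have idot : D.-integrable setT (fun s => (dot a (h s))%:E).
  under eq_fun do rewrite -sumEFin.
  apply: integrable_sum => // l _; under eq_fun do rewrite EFinM.
  exact: integrableZl.
have Edot : (\int[D]_s (dot a (h s))%:E = 0)%E.
  under eq_integral do rewrite -sumEFin.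
  rewrite integral_sum//; last first.
    by move=> l; under eq_fun do rewrite EFinM; exact: integrableZl.
  rewrite big1// => l _; under eq_integral do rewrite EFinM.
  by rewrite integralZl// Eh mule0.
rewrite (eq_integral (fun s => (((enorm a ^+ 2)%:E + (c ^+ 2)%:E * (enorm (h s) ^+ 2)%:E)
    + (- 2 * c)%:E * (dot a (h s))%:E)%E)); last first.
  move=> s _; rewrite -/(h s) enorm_sqrB enormZ exprMn real_normK ?num_real// dotZr.
  by rewrite -!EFinM -!EFinD; congr EFin; ring.
rewrite integralD//; last 2 first.
- by apply: integrableD => //; exact: integrableZl.
- exact: integrableZl.
rewrite integralZl// Edot mule0 adde0 integralD//; last exact: integrableZl.
rewrite Icst integralZl// EFinD leeD2l// (EFinM (c ^+ 2)).
by apply: lee_wpmul2l; [rewrite lee_fin sqr_ge0|exact: Eu2].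
Qed.

End Noise.

(** * Measurability of the iterates and removal of one fresh sample *)

Section Iterates.
Context {R : realType} {d n : nat} {dX : 'I_n -> measure_display}
  {X : forall i, measurableType (dX i)}.
Implicit Types (g : forall i, 'rV[R]_d -> X i -> 'rV[R]_d).

Lemma oracle_coord_measurable {dY : measure_display} {Y : measurableType dY}
    {dT : measure_display} {T : measurableType dT}
    (h : 'rV[R]_d -> Y -> 'rV[R]_d) (x : T -> 'rV[R]_d) (s : T -> Y) :
  measurable_oracle h -> coord_measurable x -> measurable_fun [set: T] s ->
  coord_measurable (fun t => h (x t) (s t)).
Proof.
move=> mh mx ms l.
have -> : (fun t => h (x t) (s t) 0 l) =
    (fun p => h (\row_(m < d) tnth p.1 m) p.2 0 l) \o
    (fun t => ([tuple x t 0 m | m < d], s t)).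
  by apply/funext => t /=; congr (h _ _ _ _); apply/rowP => m; rewrite mxE tnth_mktuple.
apply: measurableT_comp; first exact: mh.
apply: measurable_fun_pair => //; apply/measurable_fun_tnthP => m.
rewrite (_ : _ \o _ = (fun t => x t 0 m)); first exact: mx.
by apply/funext => t /=; rewrite tnth_mktuple.
Qed.

Lemma grad_coord_measurable {dT : measure_display} {T : measurableType dT}
    (f : 'rV[R]_d -> R) (L : R) (x : T -> 'rV[R]_d) :
  smooth L f -> coord_measurable x -> coord_measurable (fun t => grad f (x t)).
Proof.
move=> sf mx l; apply: (continuous_coord_measurable (h := fun y => grad f y 0 l)) mx.
apply: (@lipschitz_continuous _ _ _ L) => y z; rewrite (le_trans _ (sf y z))//.
by rewrite (le_trans _ (coord_le_enorm _ l))// !mxE.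
Qed.

(** Only samples of iterations before [k] are constrained, so the result also applies to
    sigma-algebras that omit a sample of iteration [k]. *)
Lemma rennala_coord_measurable {dT : measure_display} {T : measurableType dT}
    g gamma B (xi : forall i, nat -> nat -> T -> X i) x0 k :
  (forall i, measurable_oracle (g i)) ->
  (forall i l j, (l < k)%N -> measurable_fun [set: T] (xi i l j)) ->
  coord_measurable (rennala g gamma B xi x0 k).
Proof.
move=> mg; elim: k => [_|k IH mxi]; first exact: coord_measurable_cst.
have mk : coord_measurable (rennala g gamma B xi x0 k).
  by apply: IH => i l j lk; apply: mxi; exact: ltnW.
apply: coord_measurableB => //; do 2 apply: coord_measurableZ.
apply: coord_measurable_sum => i; apply: coord_measurable_sum => j.
by apply: oracle_coord_measurable => //; exact: mxi.
Qed.

Context {dO : measure_display} {Omega : measurableType dO} (P : probability Omega R).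

(** [x] and [a] depend only on samples other than [e]. Integrating over sample [e] first therefore
    treats them as constants, and [noise_second_moment] applies pointwise. *)
Lemma fresh_noise_second_moment (D : forall i, probability (X i) R)
    (xi : forall i, nat -> nat -> {RV P >-> X i}) (g : forall i, 'rV[R]_d -> X i -> 'rV[R]_d)
    (f : 'I_n -> 'rV[R]_d -> R) (L s2 c : R) (e : 'I_n * nat * nat)
    (x a : Omega -> 'rV[R]_d) :
  let i := e.1.1 in
  let F := g_sigma_algebraType (other_cylinders
    (fun e : 'I_n * nat * nat => xi e.1.1 e.1.2 e.2 : Omega -> X e.1.1) e) in
  fresh_samples D xi -> smooth L (f i) -> measurable_oracle (g i) ->
  unbiased (D i) (g i) (f i) -> variance_bounded s2 (D i) (g i) (f i) -> 0 <= s2 ->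
  coord_measurable (x : F -> 'rV[R]_d) -> coord_measurable (a : F -> 'rV[R]_d) ->
  (\int[P]_w (enorm (a w - c *: (g i (x w) (xi i e.1.2 e.2 w) - grad (f i) (x w))) ^+ 2)%:E
   <= \int[P]_w (enorm (a w) ^+ 2)%:E + (c ^+ 2 * s2)%:E)%E.
Proof.
move=> i F [dxi ind] sf mg ub vb s20 mx ma.
pose Y := (fun e : 'I_n * nat * nat => xi e.1.1 e.1.2 e.2 : Omega -> X e.1.1).
have mY e' : measurable_fun [set: Omega] (Y e') by exact: measurable_funP.
have mid : measurable_fun [set: Omega] (id : Omega -> F).
  move=> _ A mA; rewrite setTI preimage_id.
  by apply: (smallest_sub (@sigma_algebra_measurable _ Omega)) mA;
    exact: other_cylinders_measurable.
(* The identity, seen as a random variable into the coarser space [F], carries all the other samples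
   at once. *)
pose u : {mfun Omega >-> F} :=
  HB.pack (id : Omega -> F) (isMeasurableFun.Build _ _ _ _ (id : Omega -> F) mid).
pose phi (z : F * X i) : \bar R :=
  (enorm (a z.1 - c *: (g i (x z.1) z.2 - grad (f i) (x z.1))) ^+ 2)%:E.
have mphi : measurable_fun setT phi.
  apply/measurable_EFinP/measurable_enorm_sqr.
  have mfst (y : F -> 'rV[R]_d) : coord_measurable y ->
      coord_measurable (fun z : F * X i => y z.1).
    by move=> my l; exact: measurableT_comp (my l) measurable_fst.
  apply: coord_measurableB; first exact: mfst.
  apply: coord_measurableZ; apply: coord_measurableB.
    by apply: oracle_coord_measurable => //; exact: mfst.
  by apply: grad_coord_measurable sf _; exact: mfst.
have phi0 z : (0 <= phi z)%E by rewrite lee_fin sqr_ge0.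
rewrite (_ : \int[P]_w _ = \int[P]_w phi (u w, xi i e.1.2 e.2 w))%E//.
rewrite (integral_independent (D := D i) _ mphi phi0); last first.
  move=> A B mA mB; rewrite preimage_id.
  have := other_samples_independent (P := P) mY ind mA mB.
  by move=> ->; rewrite -(dxi i e.1.2 e.2 B mB).
have mE : measurable_fun [set: F] (fun y => (enorm (a y) ^+ 2)%:E).
  exact/measurable_EFinP/measurable_enorm_sqr.
have c0 : (0 <= c ^+ 2 * s2)%R by rewrite mulr_ge0 ?sqr_ge0.
apply: (@le_trans _ _ (\int[distribution P u]_y
    ((enorm (a y) ^+ 2)%:E + (c ^+ 2 * s2)%:E))%E).
  apply: ge0_le_integral => //.
  - by move=> y _; apply: integral_ge0.
  - exact: measurable_fun_fubini_tonelli_F.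
  - by apply: emeasurable_funD.
  - move=> y _; rewrite -EFinD /fubini_F /phi.
    have mgy : coord_measurable (fun s => g i (x y) s).
      by apply: oracle_coord_measurable => //; exact: coord_measurable_cst.
    exact: (noise_second_moment (a y) c mgy (ub (x y)) (vb (x y))).
rewrite ge0_integralD//; last by move=> y _; rewrite lee_fin sqr_ge0.
rewrite integral_cst// [X in (_ * X)%E]probability_setT mule1.
have -> : (\int[distribution P u]_y (enorm (a y) ^+ 2)%:E =
    \int[P]_w (enorm (a w) ^+ 2)%:E)%E.
  by rewrite (ge0_integral_distribution _ mE)// => y; rewrite lee_fin sqr_ge0.
exact: lexx.
Qed.

End Iterates.

(** * Recursion for the expected squared distance to the minimizers *)

Lemma contraction_factor_ge0 {R : realType} (L mu : R) :
  0 < L -> mu <= L -> 0 <= 1 - mu / (2 * L).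
Proof.
move=> L0 muL; rewrite subr_ge0 ler_pdivrMr ?mulr_gt0// mul1r (le_trans muL)//.
by rewrite ler_peMl ?(ltW L0)// ler1n.
Qed.

Section Recursion.
Context {R : realType} {d n : nat} {dX : 'I_n -> measure_display}
  {X : forall i, measurableType (dX i)} {dO : measure_display}
  {Omega : measurableType dO} (P : probability Omega R)
  (D : forall i, probability (X i) R)
  (xi : forall i, nat -> nat -> {RV P >-> X i})
  (g : forall i, 'rV[R]_d -> X i -> 'rV[R]_d) (f : 'I_n -> 'rV[R]_d -> R)
  (f0 : 'rV[R]_d -> R) (L mu s2 : R) (B : nat -> 'I_n -> nat)
  (p0 x0 : 'rV[R]_d).
Arguments g : clear implicits.
Arguments xi : clear implicits.
Hypotheses (L_gt0 : 0 < L) (mu_gt0 : 0 < mu) (mu_le : mu <= L) (s2_ge0 : 0 <= s2).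
Hypotheses (fresh : fresh_samples D xi)
  (mg : forall i, measurable_oracle (g i))
  (ub : forall i, unbiased (D i) (g i) (f i))
  (vb : forall i, variance_bounded s2 (D i) (g i) (f i)).
Hypotheses (df : forall i x, differentiable (f i) x)
  (sf : forall i, smooth L (f i))
  (cf : forall i, convex_function [set: 'rV[R]_d] (f i))
  (PL : forall i, local_PL mu (f i)).
Hypotheses (f0c : continuous f0)
  (cf0 : convex_function [set: 'rV[R]_d] f0) (f0p : minimizer f0 p0)
  (f0f : forall i z, minimizer f0 z <-> minimizer (f i) z).

Let proj := closest_minimizer f0.
Let iterate k w := rennala g L^-1 B xi x0 k w.
Let dist2 k w := enorm (iterate k w - proj (iterate k w)) ^+ 2.

Lemma coord_measurable_proj {dT : measure_display} {T : measurableType dT}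
    (Z : T -> 'rV[R]_d) : coord_measurable Z -> coord_measurable (fun t => proj (Z t)).
Proof.
move=> mZ l; apply: (continuous_coord_measurable (h := fun y => proj y 0 l)) mZ.
apply: (@lipschitz_continuous _ _ _ 1) => y z; rewrite mul1r.
rewrite (le_trans _ (closest_minimizer_nonexpansive y z f0c cf0 f0p))//.
by rewrite (le_trans _ (coord_le_enorm _ l))// !mxE.
Qed.

Lemma measurable_dist2 k : measurable_fun [set: Omega] (fun w => (dist2 k w)%:E).
Proof.
have mk : coord_measurable (iterate k).
  by apply: rennala_coord_measurable => // i l j _; exact: measurable_funP.
apply/measurable_EFinP/measurable_enorm_sqr.
exact: coord_measurableB mk (coord_measurable_proj mk).
Qed.

Section Iteration.
Variable k : nat.
Let batch : seq ('I_n * nat) := [seq (i, j) | i <- enum 'I_n, j <- iota 0 (B k i)].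
Let N : R := (\sum_(i < n) B k i)%:R.
Let x w := iterate k w.

Let sum_batch (V : nmodType) (F : 'I_n -> nat -> V) :
  \sum_(i < n) \sum_(j < B k i) F i j = \sum_(e <- batch) F e.1 e.2.
Proof.
rewrite big_allpairs_dep big_enum; apply: eq_bigr => i _.
by rewrite -(big_mkord xpredT (F i)) /index_iota subn0.
Qed.

Let batch_uniq : uniq batch.
Proof.
apply: allpairs_uniq_dep; first exact: enum_uniq.
  by move=> i _; exact: iota_uniq.
by move=> [i j] [i' j'] _ _ /= [-> ->].
Qed.

Let size_batch : (size batch)%:R = N.
Proof.
rewrite size_allpairs_dep sumnE big_map big_enum /N.
by congr (_%:R); apply: eq_bigr => i _; rewrite size_iota.
Qed.

Let noise (e : 'I_n * nat) w := g e.1 (x w) (xi e.1 k e.2 w) - grad (f e.1) (x w).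

(* What is left of [x k.+1 - proj (x k)] when the noise is removed from all
   gradients of the batch but those in [s]. *)
Let denoised (s : seq ('I_n * nat)) w :=
  x w - proj (x w) - L^-1 *: (\sum_(e <- batch) N^-1 *: grad (f e.1) (x w)) -
  \sum_(e <- s) (L^-1 * N^-1) *: noise e w.

Let denoised_second_moment s : uniq s ->
  (\int[P]_w (enorm (denoised s w) ^+ 2)%:E <=
   \int[P]_w (enorm (denoised [::] w) ^+ 2)%:E +
   ((size s)%:R * ((L^-1 * N^-1) ^+ 2 * s2))%:E)%E.
Proof.
elim: s => [_|e s IH /= /andP[es us]]; first by rewrite mul0r adde0.
apply: (@le_trans _ _ (\int[P]_w (enorm (denoised s w) ^+ 2)%:E +
    ((L^-1 * N^-1) ^+ 2 * s2)%:E)%E); last first.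
  have natS (m : nat) (K : R) : m.+1%:R * K = m%:R * K + K.
    by rewrite -natr1 mulrDl mul1r.
  move: (IH us); move: (\int[P]_w _)%E (\int[P]_w _)%E => I1 I2 I12.
  by rewrite [size _]/= natS EFinD addeA; apply: leeD2r.
have -> : (\int[P]_w (enorm (denoised (e :: s) w) ^+ 2)%:E =
    \int[P]_w (enorm (denoised s w - (L^-1 * N^-1) *: noise e w) ^+ 2)%:E)%E.
  apply: eq_integral => w _; congr (enorm _ ^+ 2)%:E.
  by rewrite /denoised big_cons opprD addrA addrAC.
pose Y := (fun e : 'I_n * nat * nat => xi e.1.1 e.1.2 e.2 : Omega -> X e.1.1).
pose F := g_sigma_algebraType (other_cylinders Y (e.1, k, e.2)).
have mY e' : e' != (e.1, k, e.2) -> measurable_fun [set: F] (Y e').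
  exact: measurable_other_sample.
have mx : coord_measurable (x : F -> 'rV[R]_d).
  apply: rennala_coord_measurable => // i l j lk; apply: (mY (i, l, j)).
  by apply/eqP => -[_ lE _]; rewrite lE ltnn in lk.
have mgrad i : coord_measurable (fun w : F => grad (f i) (x w)).
  exact: grad_coord_measurable (sf i) mx.
have ma : coord_measurable (denoised s : F -> 'rV[R]_d).
  rewrite /denoised; apply: coord_measurableB.
    apply: coord_measurableB.
      exact: coord_measurableB mx (coord_measurable_proj mx).
    by apply: coord_measurableZ; apply: coord_measurable_sum => e';
      exact: coord_measurableZ.
  (* The noise at [e] itself need not be measurable for [F], while [coord_measurable_sum] asks for
     every index; the guard replaces the terms outside [s] by 0. *)
  have nE : (fun w : F => \sum_(e' <- s) (L^-1 * N^-1) *: noise e' w) =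
      fun w => \sum_(e' <- s) if e' \in s then (L^-1 * N^-1) *: noise e' w else 0.
    by apply/funext => w; apply: eq_big_seq => e' /= ->.
  rewrite nE; apply: coord_measurable_sum => e'; case: (boolP (e' \in s)) => [e's|_]; last first.
    exact: coord_measurable_cst.
  apply: coord_measurableZ; apply: coord_measurableB => //.
  apply: oracle_coord_measurable => //; apply: (mY (e'.1, k, e'.2)).
  apply/eqP => -[e1 e2]; have ee : e = e'.
    by apply/eqP; rewrite -pair_eqE /pair_eq /= e1 e2 !eqxx.
  by rewrite ee e's in es.
exact: (fresh_noise_second_moment (L^-1 * N^-1) (e := (e.1, k, e.2))
  fresh (@sf e.1) (@mg e.1) (@ub e.1) (@vb e.1) s2_ge0 mx ma).
Qed.

Lemma dist2_recursion : 0 < N ->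
  (\int[P]_w (dist2 k.+1 w)%:E <= (1 - mu / (2 * L))%:E * \int[P]_w (dist2 k w)%:E +
    (L^-1 ^+ 2 * s2 / N)%:E)%E.
Proof.
move=> N_gt0.
have N0 : N != 0 by rewrite gt_eqF.
(* With the noise of the whole batch restored, the expression is the true next iterate seen from the
   old projection. *)
have iterS w : denoised batch w = iterate k.+1 w - proj (x w).
  rewrite /denoised /iterate /= -/(iterate k w) -/(x w).
  rewrite (sum_batch (fun i j => g i (x w) (xi i k j w))) -/N.
  rewrite -scaler_sumr -[X in _ - X]scaler_sumr /noise sumrB scalerBr -!scalerA.
  rewrite opprB addrA subrK addrAC; congr (_ - _ - _).
have contraction w :
    enorm (denoised [::] w) ^+ 2 <= (1 - mu / (2 * L)) * dist2 k w.
  rewrite /denoised big_nil subr0.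
  apply: (@gradient_step_contraction _ _ _ _ (fun=> N^-1) (fun e => f e.1) _ _ _ _ p0) => //.
  - by move=> _; rewrite invr_ge0 ltW.
  - rewrite big_const_seq count_predT iter_addr_0 -[_ *+ _]mulr_natl size_batch.
    by rewrite divff.
have q0 : 0 <= 1 - mu / (2 * L) by exact: contraction_factor_ge0.
have mi l : coord_measurable (iterate l).
  by apply: rennala_coord_measurable => // i l' j _; exact: measurable_funP.
have mxp := coord_measurableB (mi k) (coord_measurable_proj (mi k)).
have mk1 : coord_measurable (fun w => iterate k.+1 w - proj (x w)).
  exact: coord_measurableB (mi _) (coord_measurable_proj (mi _)).
have mk0 : coord_measurable (denoised [::]).
  rewrite /denoised; under eq_fun do rewrite big_nil subr0.
  apply: coord_measurableB mxp _; apply: coord_measurableZ.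
  apply: coord_measurable_sum => e; apply: coord_measurableZ.
  exact: grad_coord_measurable (@sf e.1) (mi k).
have dist2_ge0 l w : (0 <= (dist2 l w)%:E)%E by rewrite lee_fin sqr_ge0.
(* The new iterate is at least as close to its own projection as to the old one. *)
apply: (@le_trans _ _ (\int[P]_w (enorm (denoised batch w) ^+ 2)%:E)%E).
  apply: ge0_le_integral => //.
  - exact: measurable_dist2.
  - by apply/measurable_EFinP/measurable_enorm_sqr; rewrite (funext iterS).
  - move=> w _; rewrite lee_fin iterS /dist2 ler_pXn2r ?nnegrE ?enorm_ge0//.
    have [fp _] := closest_minimizerP (x w) f0c f0p.
    by have [_] := closest_minimizerP (iterate k.+1 w) f0c f0p; apply; exact: fp.
apply: (le_trans (denoised_second_moment batch_uniq)).
rewrite size_batch; apply: leeD; last first.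
  have noiseE (a b : R) : b != 0 -> b * ((a * b^-1) ^+ 2 * s2) = a ^+ 2 * s2 / b.
    by move=> b0; field.
  by rewrite noiseE.
rewrite -ge0_integralZl//; last exact: measurable_dist2.
apply: ge0_le_integral => //.
- by move=> w _; rewrite lee_fin sqr_ge0.
- exact/measurable_EFinP/measurable_enorm_sqr.
- by apply: measurable_funeM; exact: measurable_dist2.
- by move=> w _; rewrite -EFinM lee_fin.
Qed.

End Iteration.

Lemma dist2_bound (eps : R) K : 0 < eps ->
  (forall k, (k < K)%N -> 4 * s2 / (mu * L * eps) < (\sum_(i < n) B k i)%:R) ->
  (\int[P]_w (dist2 K w)%:E <=
    ((1 - mu / (2 * L)) ^+ K * enorm (x0 - proj x0)%R ^+ 2 + eps / 2)%:E)%E.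
Proof.
move=> eps0; elim: K => [_|k IH BS].
  have -> : (\int[P]_w (dist2 0 w)%:E = (enorm (x0 - proj x0)%R ^+ 2)%:E * P setT)%E.
    rewrite /dist2 /iterate /=.
    exact: (integral_cst P measurableT (enorm (x0 - proj x0)%R ^+ 2)%:E).
  rewrite [X in (_ * X)%E]probability_setT mule1 expr0 mul1r.
  by rewrite lee_fin lerDl divr_ge0// ltW.
have N0 : 0 < (\sum_(i < n) B k i)%:R :> R.
  apply: le_lt_trans (BS k (ltnSn k)).
  by rewrite divr_ge0 ?mulr_ge0// ltW// !mulr_gt0.
apply: (le_trans (dist2_recursion N0)).
have q0 : 0 <= 1 - mu / (2 * L) by exact: contraction_factor_ge0.
have {}IH : ((1 - mu / (2 * L))%:E * \int[P]_w (dist2 k w)%:E <= (1 - mu / (2 * L))%:E *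
    ((1 - mu / (2 * L)) ^+ k * enorm (x0 - proj x0)%R ^+ 2 + eps / 2)%:E)%E.
  by apply: lee_wpmul2l; [rewrite lee_fin|apply: IH => l lk; exact/BS/ltnW].
apply: (le_trans (leeD IH (le_refl _))); rewrite -EFinM -EFinD lee_fin.
rewrite mulrDr mulrA -exprS -addrA lerD2l.
(* By the choice of [S] the noise is at most mu / (2L) times eps / 2, exactly what the contraction
   removes from eps / 2; this level is thus preserved. *)
have : L^-1 ^+ 2 * s2 / (\sum_(i < n) B k i)%:R <= mu * eps / (4 * L).
  rewrite ler_pdivrMr//; have := ltW (BS k (ltnSn k)).
  rewrite ler_pdivrMr ?mulr_gt0// => h.
  rewrite -(ler_pM2l (_ : 0 < 4 * L ^+ 2)) ?mulr_gt0 ?exprn_gt0//.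
  apply: le_trans (le_trans h _); rewrite le_eqVlt; apply/orP; left; apply/eqP;
    by field; rewrite gt_eqF.
have -> : mu * eps / (4 * L) = mu / (2 * L) * (eps / 2) by field; rewrite gt_eqF.
lra.
Qed.

End Recursion.

(** * Number of iterations needed, and the degenerate case of large [mu] *)

Lemma geometric_decay {R : realType} (L mu eps r D : R) (K : nat) :
  0 < mu -> mu <= L -> 0 < eps -> 0 <= D -> D <= r ->
  4 * (L / mu) * Num.max 1 (ln (r / eps)) <= K%:R ->
  (1 - mu / (2 * L)) ^+ K * D <= eps / 2.
Proof.
move=> mu0 muL eps0 D0 Dr Kl.
have L0 : 0 < L by exact: lt_le_trans muL.
(* [r] must be positive for exp to invert the logarithm of [r / eps]; otherwise [D] is already 0. *)
have [r0|r0] := leP r 0.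
  have -> : D = 0 by apply: le_anti; rewrite D0 (le_trans Dr).
  by rewrite mulr0 divr_ge0// ltW.
have q0 : 0 < mu / (2 * L) by rewrite divr_gt0 ?mulr_gt0.
have q1 : 0 <= 1 - mu / (2 * L) by exact: contraction_factor_ge0.
(* The factor 4 makes the exponent at least twice the maximum, which covers both 1 and the
   logarithm. The extra 1 gives the factor 1/e <= 1/2 behind eps / 2. *)
have h1 : 1 + ln (r / eps) <= mu / (2 * L) * K%:R.
  apply: le_trans (ler_wpM2l (ltW q0) Kl).
  have -> : mu / (2 * L) * (4 * (L / mu) * Num.max 1 (ln (r / eps))) =
      2 * Num.max 1 (ln (r / eps)) by field; rewrite !gt_eqF.
  have : 1 <= Num.max 1 (ln (r / eps)) by rewrite le_max lexx.
  have : ln (r / eps) <= Num.max 1 (ln (r / eps)) by rewrite le_max lexx orbT.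
  lra.
have h2 : (1 - mu / (2 * L)) ^+ K <= expR (- (mu / (2 * L) * K%:R)).
  have -> : - (mu / (2 * L) * K%:R) = K%:R * - (mu / (2 * L)) by ring.
  rewrite expRM_natl; apply: lerXn2r; rewrite ?nnegrE ?expR_ge0//.
  exact: expR_ge1Dx.
have h3 : expR (- (mu / (2 * L) * K%:R)) <= (expR 1)^-1 * (r / eps)^-1.
  have -> : (r / eps)^-1 = expR (- ln (r / eps)).
    by rewrite expRN lnK// posrE divr_gt0.
  by rewrite -expRN -expRD ler_expR -opprD lerN2.
have h4 : (expR 1)^-1 <= 2^-1 :> R.
  rewrite lef_pV2 ?posrE ?expR_gt0//; exact: (expR_ge1Dx 1).
apply: (@le_trans _ _ ((expR 1)^-1 * (r / eps)^-1 * r)).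
  by apply: ler_pM => //; [exact: exprn_ge0|exact: le_trans h2 h3].
rewrite -mulrA invf_div divfK ?gt_eqF// mulrC ler_wpM2l// ltW//.
Qed.

(** PL and smoothness squeeze |grad|^2 between 2 mu and 2 L' times the gap, with L' < mu, so the gap
    is 0. The midpoint [L'] is used because [L] may be 0. *)
Lemma all_minimizers {R : realType} {d : nat} (f : 'rV[R]_d -> R) (L mu : R)
    (p x : 'rV[R]_d) :
  0 <= L -> L < mu -> (forall z, differentiable f z) -> smooth L f ->
  local_PL mu f -> minimizer f p -> minimizer f x.
Proof.
move=> L0 Lmu df sf [_ PL] fp; pose L' := (L + mu) / 2.
have L'0 : 0 < L' by rewrite /L'; lra.
have sf' : smooth L' f.
  move=> y z; apply: le_trans (sf y z) _; rewrite ler_wpM2r ?enorm_ge0// /L'; lra.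
have := le_trans (PL x) (minimizer_grad_sqr_le x L'0 df sf' fp).
rewrite (inf_minimizer fp) => h y; apply: le_trans (fp y).
rewrite -subr_le0 leNgt; apply/negP => fx.
have : 0 < (mu - L) * (f x - f p) by rewrite mulr_gt0// subr_gt0.
by move: h; rewrite /L'; lra.
Qed.

(** * Iteration and time complexity of Rennala SGD *)

Theorem theorem3p8 (R : realType) :
  exists C1 C2 : R, 0 < C1 /\ 0 < C2 /\
  forall (d n : nat) (n_gt0 : (0 < n)%N)
    (f : 'I_n -> 'rV[R]_d -> R) (L : 'I_n -> R) (mu sigma eps : R)
    (xs x0 : 'rV[R]_d)
    (dX : 'I_n -> measure_display) (X : forall i, measurableType (dX i))
    (D : forall i, probability (X i) R)
    (g : forall i, 'rV[R]_d -> X i -> 'rV[R]_d)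
    (dO : measure_display) (Omega : measurableType dO)
    (P : probability Omega R) (xi : forall i, nat -> nat -> {RV P >-> X i}),
  (forall i x, differentiable (f i) x) ->
  (forall i, 0 <= L i) ->
  (forall i, smooth (L i) (f i)) ->
  (forall i, convex_function [set: 'rV[R]_d] (f i)) ->
  minimizer (average f) xs ->
  0 <= sigma ->
  (forall i, measurable_oracle (g i)) ->
  (forall i, unbiased (D i) (g i) (f i)) ->
  (forall i, variance_bounded (sigma ^+ 2) (D i) (g i) (f i)) ->
  fresh_samples D xi ->
  strong_interpolation f ->
  0 < mu ->
  (forall i, local_PL mu (f i)) ->
  0 < eps ->
  let Lmax := \big[Num.max/0]_(i < n) L i in
  let gamma := 1 / Lmax in
  let S := 4 * sigma ^+ 2 / (mu * Lmax * eps) in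
  let logfactor := Num.max 1 (ln (enorm (x0 - xs) ^+ 2 / eps)) in
  let iterate B k w := rennala g gamma B xi x0 k w in
  let sqdist B k w :=
    enorm (iterate B k w - closest_minimizer (average f) (iterate B k w)) ^+ 2 in
  (* iteration complexity *)
  (forall (r : nat -> 'I_n -> \bar R) (h : nat -> 'I_n -> nat -> \bar R)
     (B : nat -> 'I_n -> nat) (k : nat),
     (forall l i, (0 <= r l i)%E) -> (forall l i j, (0 <= h l i j)%E) ->
     (forall l, (l <= k)%N -> collected S (finish_time (r l) (h l)) (B l)) ->
     C1 * (Lmax / mu) * logfactor <= k%:R ->
     ('E_P[sqdist B k.+1] <= eps%:E)%E) /\
  (* time complexity: [K] iterations are completed within the given time *)
  (forall (tau : 'I_n -> R)
     (r : nat -> 'I_n -> \bar R) (h : nat -> 'I_n -> nat -> \bar R),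
     (forall i, 0 < tau i) ->
     (forall i j : 'I_n, (i <= j)%N -> tau i <= tau j) ->
     (forall l i, (0 <= r l i)%E) -> (forall l i j, (0 <= h l i j)%E) ->
     fixed_computation_model tau r h ->
     let seconds (m : nat) :=
       (m%:R^-1 * \sum_(i < n | (i < m)%N) (tau i)^-1)^-1 *
       (Lmax / mu + sigma ^+ 2 / (m%:R * eps * mu ^+ 2)) in
     exists K : nat,
       (\sum_(k < K) stop_time S (finish_time (r k) (h k)) <=
        (C2 * \big[Num.min/seconds 1%N]_(1 <= m < n.+1) seconds m * logfactor)%:E)%E /\
       forall B : nat -> 'I_n -> nat,
         (forall k, (k < K)%N -> collected S (finish_time (r k) (h k)) (B k)) ->
         ('E_P[sqdist B K] <= eps%:E)%E).
Proof.
(* 4 comes from [geometric_decay]; 24 dominates the coefficients 20 and 10 found at the end. *)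
exists 4, 24; split=> //; split=> //.
move=> d n n_gt0 f L mu sigma eps xs x0 dX X D g dO Omega P xi df L_ge0 sfL cf.
move=> xs_min sigma0 mg ub vb fresh interp mu0 PL eps0 Lmax gamma S logf iterate sqdist.
pose i0 := Ordinal n_gt0.
have fmin i : minimizer (f i) xs by apply/(interp i).
(* By interpolation a single [f i0] has the minimizers of the average and can replace it in every
   projection argument. *)
have f0f i z : minimizer (f i0) z <-> minimizer (f i) z.
  by split=> /interp h; apply/interp.
have f0c : continuous (f i0) by move=> z; exact/differentiable_continuous/df.
have LLmax i : L i <= Lmax by exact: (le_bigmax _ L i).
have sf i : smooth Lmax (f i).
  by move=> y z; rewrite (le_trans (sfL i y z))// ler_wpM2r// enorm_ge0.
have Lmax0 : 0 <= Lmax by exact: le_trans (L_ge0 i0) (LLmax i0).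
have clE : closest_minimizer (average f) = closest_minimizer (f i0).
  by apply: closest_minimizer_eq => z; split=> /interp.
have D0 := (closest_minimizerP x0 f0c (fmin i0)).2 xs (fmin i0).
have logf1 : 1 <= logf by rewrite le_max lexx.
have s20 : 0 <= sigma ^+ 2 by exact: sqr_ge0.
have S0 : 0 <= S by rewrite divr_ge0 ?mulr_ge0// ltW.
(* When [Lmax < mu] the [f i] are constant and no iteration is needed, although
   the time bound may then be too small for even one iteration. *)
have trivial_case B k : Lmax < mu -> ('E_P[sqdist B k] <= eps%:E)%E.
  move=> Lmu; rewrite unlock (eq_integral (fun=> 0%E)) ?integral0 ?lee_fin ?ltW//.
  move=> w _; rewrite /sqdist clE; congr (_%:E).
  have xmin x : minimizer (f i0) x.
    exact: all_minimizers Lmax0 Lmu (df i0) (sf i0) (PL i0) (fmin i0).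
  have := (closest_minimizerP (iterate B k w) f0c (fmin i0)).2 _ (xmin (iterate B k w)).
  rewrite subrr enorm0 => dist_le0; apply/eqP; rewrite sqrf_eq0 eq_le enorm_ge0.
  by rewrite dist_le0.
have accuracy B K : (forall k, (k < K)%N -> S < (\sum_(i < n) B k i)%:R) ->
    4 * (Lmax / mu) * logf <= K%:R -> ('E_P[sqdist B K] <= eps%:E)%E.
  move=> BS Kl; have [muL|] := leP mu Lmax; last exact: trivial_case.
  have L0 : 0 < Lmax by exact: lt_le_trans muL.
  rewrite unlock /sqdist clE /iterate /gamma div1r.
  apply: (le_trans (dist2_bound x0 L0 mu0 muL s20 fresh mg ub vb df sf cf PL f0c (cf i0)
    (fmin i0) f0f eps0 BS)).
  rewrite lee_fin.
  have := geometric_decay mu0 muL eps0 (sqr_ge0 _) _ Kl.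
  move=> /(_ (enorm (x0 - closest_minimizer (f i0) x0))).
  rewrite ler_pXn2r ?nnegrE ?enorm_ge0// => /(_ D0); lra.
split.
  move=> r h B k _ _ coll kl; apply: accuracy.
    by move=> l lk; have [] := coll l lk.
  by rewrite (le_trans kl)// ler_nat.
move=> tau r h tau0 _ r0 h0 [rtau htau] seconds.
have H0 m : (0 < m <= n)%N -> 0 < \sum_(i < n | (i < m)%N) (tau i)^-1.
  move=> /andP[m0 mn]; rewrite (bigD1 i0)//= ltr_pwDl ?invr_gt0// sumr_ge0// => i _.
  by rewrite invr_ge0 ltW.
have secondsE m : (0 < m <= n)%N -> seconds m =
    (m%:R * (Lmax / mu) + sigma ^+ 2 / (eps * mu ^+ 2)) / \sum_(i < n | (i < m)%N) (tau i)^-1.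
  move=> mn; have m0 : m%:R != 0 :> R by case/andP: mn => m0 _; rewrite pnatr_eq0 -lt0n.
  have := H0 m mn; rewrite /seconds; move: (\sum_(i < n | _) _) => H H1.
  by field; rewrite m0 !gt_eqF.
(* The minimum is one of the values [seconds m], so a bound proved for every [m] holds for it. *)
have min_seconds (Q : R -> Prop) : (forall m, (0 < m <= n)%N -> Q (seconds m)) ->
    Q (\big[Num.min/seconds 1%N]_(1 <= m < n.+1) seconds m).
  move=> Qs; rewrite big_nat; apply: big_ind; first exact: Qs.
    by move=> a b; rewrite minEle; case: ifP.
  by move=> m; rewrite ltnS => /Qs.
have [muL|Lmu] := leP mu Lmax; last first.
  exists 0%N; split; last by move=> B _; exact: trivial_case.
  rewrite big_ord0.
  apply: (min_seconds (fun v => (0 <= (24 * v * logf)%:E)%E)) => m mn; rewrite lee_fin secondsE//.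
  apply: mulr_ge0; last exact: le_trans ler01 logf1.
  apply: mulr_ge0 => //; apply: divr_ge0; last exact/ltW/H0.
  apply: addr_ge0; first by apply: mulr_ge0 => //; apply: divr_ge0 => //; exact: ltW.
  by apply: divr_ge0 => //; apply: mulr_ge0; [exact: ltW|exact: sqr_ge0].
have L0 : 0 < Lmax by exact: lt_le_trans muL.
have Lmu1 : 1 <= Lmax / mu by rewrite ler_pdivlMr// mul1r.
have T0 : 0 <= 4 * (Lmax / mu) * logf.
  by rewrite !mulr_ge0// ?invr_ge0 ?(ltW mu0)// (le_trans ler01).
pose K := (Num.truncn (4 * (Lmax / mu) * logf)).+1; exists K; split; last first.
  move=> B coll; apply: accuracy; last exact/ltW/truncnS_gt.
  by move=> k kK; have [] := coll k kK.
apply: (min_seconds (fun v =>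
  (\sum_(k < K) stop_time S (finish_time (r k) (h k)) <= (24 * v * logf)%:E)%E)) => m mn.
set t := (S + 2 * m%:R) / \sum_(i < n | (i < m)%N) (tau i)^-1.
apply: (@le_trans _ _ (\sum_(k < K) t%:E)%E).
  by apply: lee_sum => k _; exact: stop_time_le.
rewrite sumEFin lee_fin sumr_const card_ord -[leLHS]mulr_natl secondsE//.
(* Rounding up adds at most 1, which is absorbed since Lmax / mu and the log factor are both at
   least 1. *)
have K5 : K%:R <= 5 * (Lmax / mu * logf).
  have y1 : 1 <= Lmax / mu * logf by rewrite mulr_ege1.
  have h1 : (Num.truncn (4 * (Lmax / mu) * logf))%:R <= 4 * (Lmax / mu * logf).
    by rewrite [leRHS]mulrA truncn_le.
  rewrite /K -[leLHS]natr1 (le_trans (lerD h1 y1))// -[X in _ + X <= _]mul1r -mulrDl.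
  by rewrite natr1.
have Hm := H0 m mn; rewrite /t; move: (\sum_(i < n | _) _) Hm => H Hm.
have t0 : 0 <= (S + 2 * m%:R) / H.
  by apply: divr_ge0; [apply: addr_ge0 => //; exact: mulr_ge0|exact: ltW].
apply: (le_trans (ler_wpM2r t0 K5)).
(* [Lmax] cancels against the one in [S]: 5 times 4 gives 20 for the variance term, and 5 times 2
   gives 10 for the other. *)
have -> : 5 * (Lmax / mu * logf) * ((S + 2 * m%:R) / H) =
    logf / H * (20 * (sigma ^+ 2 / (eps * mu ^+ 2)) + 10 * (m%:R * (Lmax / mu))).
  by rewrite /S; field; rewrite !gt_eqF.
rewrite [leRHS](_ : _ = logf / H * (24 * (sigma ^+ 2 / (eps * mu ^+ 2)) +
  24 * (m%:R * (Lmax / mu)))); last by field; rewrite !gt_eqF.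
rewrite ler_wpM2l ?divr_ge0 ?(ltW Hm) ?(le_trans ler01 logf1)//.
have a0 : 0 <= sigma ^+ 2 / (eps * mu ^+ 2).
  by apply: divr_ge0 => //; apply: mulr_ge0; [exact: ltW|exact: sqr_ge0].
have b0 : 0 <= m%:R * (Lmax / mu).
  by apply: mulr_ge0 => //; exact: le_trans ler01 Lmu1.
by apply: lerD; rewrite ler_wpM2r// ler_nat.
Qed.
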